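(* Let $\mathrm{P}\in\mathcal{P}$, let $\Omega$ be an open subset of the complex plane and let $\gamma$ be a cycle in $\Omega$ homologous to zero with respect to $\Omega$. Let $f$ be analytic in $\Omega$, let $x\in\Omega$ with $\mathrm{Ind}(\gamma,x)=1$, let $n\ge 0$ be an integer, and let $(z_t)_{t\in\frac12\mathbb{Z}}$ be a $\mathrm{P}$-sequence such that $z_j\in\Omega$ and $\mathrm{Ind}(\gamma,z_j)=1$ for $j=0,1,\ldots,n$. Then $$f(x)=\sum_{k=0}^n \partial_k f(z_{k/2})\prod_{j=0}^{k-1}(x-z_j)\;+\;\mathcal{R}_nf(x),$$ where $$\mathcal{R}_nf(x)=\frac{1}{2\pi i}\int_\gamma \frac{f(y)}{y-x}\prod_{j=0}^n\frac{x-z_j}{y-z_j}\,dy .$$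
   Context: $\mathcal{P}$ denotes the set of polynomials $\mathrm{P}(x,y)=x^2+y^2-2axy-2b(x+y)+c$ with $a,b,c\in\mathbb{C}$. A $\mathrm{P}$-sequence is a sequence of complex numbers $(x_t)$ indexed by $t\in\frac12\mathbb{Z}=\{k/2:k\in\mathbb{Z}\}$ such that $\mathrm{P}(x_t,y)=(y-x_{t+\frac12})(y-x_{t-\frac12})$ (as polynomials in $y$) for all $t\in\frac12\mathbb{Z}$; $x_0$ is called its base point. For $x\in\mathbb{C}$ and any $\mathrm{P}$-sequence $(x_t)$ with base point $x_0=x$, put $\Phi_0(x,y)=1$ and $\Phi_k(x,y)=\prod_{j=0}^{k-1}(y-x_{j-\frac{k-1}{2}})$ for $k\ge1$; this does not depend on the chosen $\mathrm{P}$-sequence with base point $x$. Write $A(x)=ax+b$ and $\delta(x)=(a^2-1)x^2+2b(a+1)x+b^2-c$, so that the roots of $y\mapsto\mathrm{P}(x,y)$ are $A(x)\pm\sqrt{\delta(x)}$. Put $\Omega_0=\Omega$ and $\Omega_{k+1}=\{x\in\mathbb{C}: A(x)\pm\sqrt{\delta(x)}\in\Omega_k\}$. Let $\mathcal{H}(U)$ be the space of analytic functions on the open set $U$. The operator $\partial_k:\mathcal{H}(\Omega)\to\mathcal{H}(\Omega_k)$ is defined by $$\partial_kf(x)=\frac{1}{2\pi i}\int_{\gamma'}\frac{f(y)}{\Phi_{k+1}(x,y)}\,dy,$$ where $\gamma'$ is any cycle in $\Omega$ homologous to zero with respect to $\Omega$ with $\mathrm{Ind}(\gamma',x_{j-\frac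 k2})=1$ for $j=0,\ldots,k$, $(x_t)$ being a $\mathrm{P}$-sequence with base point $x$. In particular $\Phi_{k+1}(z_{k/2},y)=\prod_{j=0}^k(y-z_j)$ for a $\mathrm{P}$-sequence $(z_t)$. $\mathrm{Ind}(\gamma,z)$ denotes the index (winding number) of $\gamma$ with respect to $z$. Empty products equal 1. *)

(* Defs.v *)
From Stdlib Require Import Reals ZArith List.
From Coquelicot Require Import Coquelicot.
Import ListNotations.

Open Scope R_scope.
Open Scope C_scope.

(* The derivative at the end points of [u, v] is the one-sided one, since the
   filter only sees points of [u, v]. *)
Definition C1_on (g : R -> C) (u v : R) : Prop :=
  exists dg : R -> C, forall t : R, (u <= t <= v)%R ->
    let F := within (fun s : R => (u <= s <= v)%R) (locally t) in
    filterdiff (U := R_NormedModule) (V := C_R_NormedModule)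
      g F (fun h : R => scal h (dg t))
    /\ filterlim dg F (locally (dg t)).

(* [ts] lists the successive nodes of the subdivision that follow [u], the last
   of which is [v].  Consecutive pieces share a node, so that [g] is continuous
   on [u, v]. *)
Fixpoint C1_pieces (g : R -> C) (u v : R) (ts : list R) : Prop :=
  match ts with
  | [] => u = v
  | t :: ts' => (u < t)%R /\ C1_on g u t /\ C1_pieces g t v ts'
  end.

Definition piecewise_C1 (g : R -> C) (u v : R) : Prop :=
  exists ts : list R, C1_pieces g u v ts.

Record closed_path := {
  path_fun :> R -> C;
  path_lo : R;
  path_hi : R;
  path_lt : (path_lo < path_hi)%R;
  path_C1 : piecewise_C1 path_fun path_lo path_hi;
  path_closed : path_fun path_lo = path_fun path_hi
}.

(* Componentwise; meaningful except possibly at the finitely many nodes of the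
   subdivision, which the Riemann integral does not see. *)
Definition path_derive (g : R -> C) (t : R) : C :=
  (Derive (fun s => Re (g s)) t, Derive (fun s => Im (g s)) t).

Definition path_integral (g : closed_path) (F : C -> C) : C :=
  RInt (V := C_R_CompleteNormedModule)
    (fun t : R => F (g t) * path_derive g t) (path_lo g) (path_hi g).

(* A formal sum of closed paths.  An integer combination is obtained by
   repeating a path, and by reversing it for negative coefficients. *)
Definition cycle := list closed_path.

Definition on_cycle (gamma : cycle) (z : C) : Prop :=
  exists g : closed_path, In g gamma /\
    exists t : R, (path_lo g <= t <= path_hi g)%R /\ g t = z.

Definition cycle_integral (gamma : cycle) (F : C -> C) : C :=
  fold_right (fun g s => path_integral g F + s) 0 gamma.

(* Only meaningful for [z] outside the trace of [gamma]. *)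
Definition Ind (gamma : cycle) (z : C) : C :=
  / (2 * PI * Ci) * cycle_integral gamma (fun w => / (w - z)).

Definition has_index_one (gamma : cycle) (z : C) : Prop :=
  ~ on_cycle gamma z /\ Ind gamma z = 1.

Definition cycle_in (Omega : C -> Prop) (gamma : cycle) : Prop :=
  forall z : C, on_cycle gamma z -> Omega z.

Definition homologous_to_zero (Omega : C -> Prop) (gamma : cycle) : Prop :=
  forall z : C, ~ Omega z -> Ind gamma z = 0.

Definition analytic_on (Omega : C -> Prop) (f : C -> C) : Prop :=
  forall z : C, Omega z ->
    ex_derive (K := C_AbsRing) (V := C_NormedModule) f z.

Fixpoint Cprod (u : nat -> C) (n : nat) : C :=
  match n with
  | O => 1
  | S m => Cprod u m * u m
  end.

Definition Ppoly (a b c x y : C) : C :=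
  x * x + y * y - 2 * a * x * y - 2 * b * (x + y) + c.

(* A family (x_t) indexed by half-integers is represented by the function
   [xs : Z -> C] such that [xs m] stands for x_{m/2}.  As C is infinite,
   equality of polynomials in y is equality at all y. *)
Definition P_sequence (a b c : C) (xs : Z -> C) : Prop :=
  forall (m : Z) (y : C),
    Ppoly a b c (xs m) y = (y - xs (m + 1)%Z) * (y - xs (m - 1)%Z).

(* Phi_k(x, y) for the base point x = [xs 0]: the j-th factor is
   y - x_{j - (k-1)/2}. *)
Definition Phi (xs : Z -> C) (k : nat) (y : C) : C :=
  Cprod (fun j => y - xs (2 * Z.of_nat j - (Z.of_nat k - 1))%Z) k.

Definition A_of (a b x : C) : C := a * x + b.

Definition delta_of (a b c x : C) : C :=
  (a * a - 1) * (x * x) + 2 * b * (a + 1) * x + b * b - c.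

Fixpoint Omega_iter (a b c : C) (Omega : C -> Prop) (k : nat) : C -> Prop :=
  match k with
  | O => Omega
  | S k' => fun x => forall s : C, s * s = delta_of a b c x ->
      Omega_iter a b c Omega k' (A_of a b x + s)
      /\ Omega_iter a b c Omega k' (A_of a b x - s)
  end.

Definition is_partial (a b c : C) (Omega : C -> Prop) (k : nat)
    (f : C -> C) (x v : C) : Prop :=
  Omega_iter a b c Omega k x /\
  exists (xs : Z -> C) (gamma' : cycle),
    P_sequence a b c xs /\ xs 0%Z = x
    /\ cycle_in Omega gamma'
    /\ homologous_to_zero Omega gamma'
    /\ (forall j : nat, (j <= k)%nat ->
         has_index_one gamma' (xs (2 * Z.of_nat j - Z.of_nat k)%Z))
    /\ v = / (2 * PI * Ci) * cycle_integral gamma' (fun y => f y / Phi xs (S k) y).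

(* [iota] is definite description: this is the one value given by all
   admissible choices of the P-sequence and of the cycle (and unspecified if
   there is not exactly one such value). *)
Definition partial (a b c : C) (Omega : C -> Prop) (k : nat)
    (f : C -> C) (x : C) : C :=
  iota (T := C_R_CompleteNormedModule) (is_partial a b c Omega k f x).

Definition remainder (gamma : cycle) (z : Z -> C) (n : nat)
    (f : C -> C) (x : C) : C :=
  / (2 * PI * Ci) *
  cycle_integral gamma (fun y =>
    f y / (y - x) *
    Cprod (fun j => (x - z (2 * Z.of_nat j)%Z) / (y - z (2 * Z.of_nat j)%Z))
      (S n)).

(* Main.v *)
(* Integrating over gamma the Newton identity for f(y) / (y - x) and applying
   Cauchy's formula at x gives the expansion, with the coefficients
   1/(2 pi i) int_gamma f / Phi_{k+1}.  These are the values of the operators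
   partial_k: any two cycles admissible in their definition have a difference
   that is homologous to zero in Omega without the points z_j, where f / Phi_{k+1}
   is analytic, and two P-sequences with the same base point agree up to the
   reversal t -> -t, which does not change Phi_{k+1}.

   The homology form of Cauchy's theorem is obtained by Dixon's method, for
   abstract functionals L on functions continuous along a compact set, so that
   circles, cycles and differences of cycles are covered at once.  The local
   theory rests on Caratheodory's form of differentiability, for which the
   difference quotient slope f w0 is again analytic, and satisfies
   slope f w - slope f w0 = (w - w0) slope (slope f w0) w.  Hence
   w |-> L (slope f w) can be differentiated without exchanging integrals. *)

Require Import Defs.
From Stdlib Require Import Reals ZArith List Lra Lia Classical ClassicalEpsilon.
From Coquelicot Require Import Coquelicot.
Open Scope R_scope.
Open Scope C_scope.

(** * Complex differentiability *)

(** The operators are defined by description over all admissible cycles, and such a cycle need share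
    nothing with gamma but its indices at the nodes. Evaluating a single coefficient therefore
    already takes the full homology theorem, however explicit the expansion is. The nodes are dealt
    with by deleting them from Omega, not by residues, so that coinciding nodes need no separate
    treatment. The other obstacle is a threat of circularity. Dixon's method wants the difference
    quotient differentiable at its own base point; this is a removable singularity, hence
    presupposes Cauchy's formula on some curve. That curve is a circle: Goursat's bisection runs in
    the parameter rectangle of a contraction of the circle towards an interior point, at which the
    integrand only has to be continuous. Linearity, a bound by the supremum over K, boundedness of
    continuous functions on K and vanishing on double poles are all that the global argument uses of
    integration. *)

Ltac C_eq := match goal with |- @eq _ ?x ?y => change (@eq C x y) end.

Lemma locally_Cmod (z : C) (P : C -> Prop) :
  locally (T := C_UniformSpace) z P <->
  exists d : R, (0 < d)%R /\ forall w, (Cmod (w - z) < d)%R -> P w.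
Proof.
  rewrite locally_C; split.
  - intros [d Hd]; exists d; split; [apply cond_pos|].
    intros w Hw; apply Hd; exact Hw.
  - intros [d [Hd H]]; exists (mkposreal d Hd); intros w Hw; apply H; exact Hw.
Qed.

Lemma continuous_Cmod {T : UniformSpace} (f : T -> C) (x : T) :
  continuous (U := C_UniformSpace) f x <->
  forall eps : R, (0 < eps)%R -> locally x (fun y => (Cmod (f y - f x) < eps)%R).
Proof.
  split; intros H.
  - intros eps Heps.
    apply (H (fun w => (Cmod (w - f x) < eps)%R)).
    apply locally_Cmod; exists eps; split; [exact Heps|auto].
  - intros P HP; apply locally_Cmod in HP; destruct HP as [d [Hd HP]].
    refine (filter_imp _ _ _ (H d Hd)); intros y Hy; apply HP, Hy.
Qed.

Lemma continuous_C_at (f : C -> C) (z : C) :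
  continuous (T := C_UniformSpace) (U := C_UniformSpace) f z <->
  forall eps : R, (0 < eps)%R -> exists d : R, (0 < d)%R /\
    forall w, (Cmod (w - z) < d)%R -> (Cmod (f w - f z) < eps)%R.
Proof.
  rewrite continuous_Cmod; split; intros H eps He; specialize (H eps He);
    apply locally_Cmod; exact H.
Qed.

Lemma continuous_Cplus {T : UniformSpace} (f g : T -> C) (x : T) :
  continuous (U := C_UniformSpace) f x -> continuous (U := C_UniformSpace) g x ->
  continuous (U := C_UniformSpace) (fun y => f y + g y) x.
Proof.
  intros Hf Hg.
  exact (continuous_plus (V := C_R_NormedModule) f g x Hf Hg).
Qed.

Lemma continuous_Copp {T : UniformSpace} (f : T -> C) (x : T) :
  continuous (U := C_UniformSpace) f x ->
  continuous (U := C_UniformSpace) (fun y => - f y) x.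
Proof.
  intros Hf; exact (continuous_opp (V := C_R_NormedModule) f x Hf).
Qed.

Lemma continuous_Cminus {T : UniformSpace} (f g : T -> C) (x : T) :
  continuous (U := C_UniformSpace) f x -> continuous (U := C_UniformSpace) g x ->
  continuous (U := C_UniformSpace) (fun y => f y - g y) x.
Proof.
  intros Hf Hg; apply continuous_Cplus; [|apply continuous_Copp]; assumption.
Qed.

Lemma continuous_Cconst {T : UniformSpace} (k : C) (x : T) :
  continuous (U := C_UniformSpace) (fun _ => k) x.
Proof. apply continuous_const. Qed.

Lemma continuous_Cid (z : C) :
  continuous (T := C_UniformSpace) (U := C_UniformSpace) (fun w => w) z.
Proof. apply continuous_id. Qed.

Lemma continuous_Cmult {T : UniformSpace} (f g : T -> C) (x : T) :
  continuous (U := C_UniformSpace) f x -> continuous (U := C_UniformSpace) g x ->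
  continuous (U := C_UniformSpace) (fun y => f y * g y) x.
Proof.
  intros Hf Hg.
  rewrite continuous_Cmod in Hf, Hg |- *.
  intros eps Heps.
  set (A := Cmod (f x)); set (B := Cmod (g x)).
  assert (HA : (0 <= A)%R) by apply Cmod_ge_0.
  assert (HB : (0 <= B)%R) by apply Cmod_ge_0.
  (* With both increments below [e <= 1], the product moves by at most [e * (e + A + B)], which is
     less than [e * (A + B + 2)]. *)
  set (e := Rmin 1 (eps / (A + B + 2))).
  assert (He : (0 < e)%R).
  { apply Rmin_pos; [lra|apply Rdiv_lt_0_compat; lra]. }
  assert (He1 : (e <= 1)%R) by apply Rmin_l.
  assert (He2 : (e * (A + B + 2) <= eps)%R).
  { replace eps with (eps / (A + B + 2) * (A + B + 2))%R by (field; lra).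
    apply Rmult_le_compat_r; [lra|apply Rmin_r]. }
  generalize (filter_and _ _ (Hf e He) (Hg e He)).
  apply filter_imp; intros y [H1 H2].
  replace (f y * g y - f x * g x)
    with ((f y - f x) * (g y - g x) + f x * (g y - g x) + (f y - f x) * g x) by ring.
  eapply Rle_lt_trans; [apply Cmod_triangle|].
  eapply Rle_lt_trans; [apply Rplus_le_compat_r, Cmod_triangle|].
  rewrite !Cmod_mult; fold A B.
  assert (H3 := Cmod_ge_0 (f y - f x)); assert (H4 := Cmod_ge_0 (g y - g x)).
  nra.
Qed.

Lemma continuous_Cinv {T : UniformSpace} (f : T -> C) (x : T) :
  continuous (U := C_UniformSpace) f x -> f x <> 0 ->
  continuous (U := C_UniformSpace) (fun y => / f y) x.
Proof.
  intros Hf Hx.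
  rewrite continuous_Cmod in Hf |- *.
  intros eps Heps.
  set (A := Cmod (f x)).
  assert (HA : (0 < A)%R) by (apply Cmod_gt_0; exact Hx).
  (* The first bound keeps |f y| above [A / 2]; the second makes |f y - f x| smaller than [eps]
     times A^2 / 2, which is a lower bound of |f y| |f x|. *)
  assert (He : (0 < Rmin (A / 2) (eps * (A * A) / 2))%R).
  { apply Rmin_pos; [lra|]. assert (0 < A * A)%R by nra. nra. }
  generalize (Hf _ He); apply filter_imp; intros y Hy.
  assert (Hy1 := Rlt_le_trans _ _ _ Hy (Rmin_l _ _)).
  assert (Hy2 := Rlt_le_trans _ _ _ Hy (Rmin_r _ _)).
  assert (H1 : (A / 2 < Cmod (f y))%R).
  { assert (H := Cmod_triangle (f x - f y) (f y)).
    replace (f x - f y + f y) with (f x) in H by ring.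
    replace (f x - f y) with (- (f y - f x)) in H by ring.
    rewrite Cmod_opp in H; fold A in H; lra. }
  assert (Hy0 : f y <> 0) by (apply Cmod_gt_0; lra).
  replace (/ f y - / f x) with (- (f y - f x) / (f y * f x)) by (field; auto).
  rewrite Cmod_div by (apply Cmult_neq_0; auto).
  rewrite Cmod_opp, Cmod_mult; fold A.
  assert (Hp : (0 < Cmod (f y) * A)%R) by nra.
  apply Rmult_lt_reg_r with (Cmod (f y) * A)%R; [exact Hp|].
  unfold Rdiv; rewrite Rmult_assoc, Rinv_l by (apply Rgt_not_eq; exact Hp).
  assert (H2 : (0 < eps * A)%R) by nra.
  assert (H3 : (eps * (A * A) / 2 <= eps * (Cmod (f y) * A))%R) by nra.
  lra.
Qed.

Lemma continuous_Cdiv {T : UniformSpace} (f g : T -> C) (x : T) :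
  continuous (U := C_UniformSpace) f x -> continuous (U := C_UniformSpace) g x ->
  g x <> 0 ->
  continuous (U := C_UniformSpace) (fun y => f y / g y) x.
Proof.
  intros Hf Hg H; apply continuous_Cmult; [|apply continuous_Cinv]; assumption.
Qed.

Definition differentiable_at (f : C -> C) (z : C) : Prop :=
  ex_derive (K := C_AbsRing) (V := C_NormedModule) f z.

(* Caratheodory's form of the derivative. *)
Definition factors_at (f : C -> C) (z : C) (q : C -> C) : Prop :=
  continuous (T := C_UniformSpace) (U := C_UniformSpace) q z /\
  locally (T := C_UniformSpace) z (fun w => f w = f z + (w - z) * q w).

Lemma factors_at_global (f : C -> C) (z : C) (q : C -> C) :
  continuous (T := C_UniformSpace) (U := C_UniformSpace) q z ->
  (forall w : C, f w = f z + (w - z) * q w) -> factors_at f z q.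
Proof. intros Hq H; split; [exact Hq|apply filter_forall, H]. Qed.

Lemma factors_at_is_derive (f q : C -> C) (z : C) :
  factors_at f z q -> is_derive (K := C_AbsRing) (V := C_NormedModule) f z (q z).
Proof.
  intros [Hq Hf]; split.
  - apply is_linear_scal_l.
  - intros x Hx.
    replace x with z by exact (is_filter_lim_locally_unique _ _ Hx).
    intros eps.
    rewrite continuous_Cmod in Hq.
    apply (proj1 (locally_C z _)).
    generalize (filter_and _ _ Hf (Hq eps (cond_pos eps))); apply filter_imp.
    intros w [H1 H2].
    change (Cmod ((f w - f z) - (w - z) * q z) <= eps * Cmod (w - z))%R.
    rewrite H1.
    replace (f z + (w - z) * q w - f z - (w - z) * q z)
      with ((q w - q z) * (w - z)) by ring.
    rewrite Cmod_mult; apply Rmult_le_compat_r; [apply Cmod_ge_0|lra].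
Qed.

(** The base point comes first. The diagonal value makes [slope f w] continuous at [w] as soon as f
    is differentiable there, while the factorization [slope_eq] holds for every f and all points. *)
Definition slope (f : C -> C) (w z : C) : C :=
  if Ceq_dec z w then C_derive f w else (f z - f w) / (z - w).

Lemma slope_diag (f : C -> C) (w : C) : slope f w w = C_derive f w.
Proof. unfold slope; destruct (Ceq_dec w w); tauto. Qed.

Lemma slope_neq (f : C -> C) (w z : C) :
  z <> w -> slope f w z = (f z - f w) / (z - w).
Proof. unfold slope; destruct (Ceq_dec z w); tauto. Qed.

Lemma slope_eq (f : C -> C) (w z : C) : f z = f w + (z - w) * slope f w z.
Proof.
  unfold slope; destruct (Ceq_dec z w) as [->|H]; [ring|].
  field; intros E; apply H; replace z with (z - w + w) by ring; rewrite E; ring.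
Qed.

Lemma slope_factors (f : C -> C) (w : C) :
  differentiable_at f w -> factors_at f w (slope f w).
Proof.
  intros H; apply C_derive_correct in H; [|exact 0].
  split.
  2: apply filter_forall; intros z; apply slope_eq.
  apply continuous_Cmod; intros eps Heps.
  destruct H as [_ H]; specialize (H w (fun P HP => HP)).
  assert (He : (0 < eps / 2)%R) by lra.
  specialize (H (mkposreal _ He)).
  apply (proj2 (locally_C w _)) in H.
  revert H; apply filter_imp; intros z Hz.
  change (Cmod ((f z - f w) - (z - w) * C_derive f w) <= eps / 2 * Cmod (z - w))%R in Hz.
  rewrite slope_diag.
  unfold slope; destruct (Ceq_dec z w) as [->|Hn].
  { replace (C_derive f w - C_derive f w) with (RtoC 0) by ring. rewrite Cmod_0; exact Heps. }
  assert (Hn' : z - w <> 0) by (apply Cminus_eq_contra; exact Hn).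
  replace ((f z - f w) / (z - w) - C_derive f w)
    with (((f z - f w) - (z - w) * C_derive f w) / (z - w)) by (field; exact Hn').
  rewrite Cmod_div by exact Hn'.
  assert (Hp : (0 < Cmod (z - w))%R) by (apply Cmod_gt_0; exact Hn').
  apply Rmult_lt_reg_r with (Cmod (z - w)); [exact Hp|].
  unfold Rdiv; rewrite Rmult_assoc, Rinv_l by lra.
  nra.
Qed.

Lemma factors_at_differentiable (f q : C -> C) (z : C) :
  factors_at f z q -> differentiable_at f z.
Proof. intros H; exists (q z); apply factors_at_is_derive, H. Qed.

(** Caratheodory factors are unique: away from [w] by division, at [w] because the derivative is
    unique. This identifies slopes with integrals or algebraic expressions, the diagonal
    included. *)
Lemma factors_at_slope (f q : C -> C) (w z : C) :
  factors_at f w q -> f z = f w + (z - w) * q z -> slope f w z = q z.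
Proof.
  intros H E; unfold slope; destruct (Ceq_dec z w) as [->|Hn].
  - apply is_C_derive_unique, factors_at_is_derive, H.
  - rewrite E; field; apply Cminus_eq_contra, Hn.
Qed.

Lemma differentiable_continuous (f : C -> C) (z : C) :
  differentiable_at f z ->
  continuous (T := C_UniformSpace) (U := C_UniformSpace) f z.
Proof.
  intros H; apply slope_factors in H; destruct H as [Hq _].
  apply continuous_ext with (fun w => f z + (w - z) * slope f z w).
  { intros w; symmetry; apply slope_eq. }
  apply continuous_Cplus; [apply continuous_Cconst|].
  apply continuous_Cmult; [|exact Hq].
  apply continuous_Cminus; [apply continuous_Cid|apply continuous_Cconst].
Qed.

Lemma differentiable_ext_loc (f g : C -> C) (z : C) :
  locally (T := C_UniformSpace) z (fun w => f w = g w) ->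
  differentiable_at f z -> differentiable_at g z.
Proof.
  intros H; apply ex_derive_ext_loc.
  apply (proj1 (locally_C z _)), H.
Qed.

Lemma differentiable_const (k z : C) : differentiable_at (fun _ => k) z.
Proof.
  apply factors_at_differentiable with (fun _ => 0);
    apply factors_at_global.
  - apply continuous_Cconst.
  - intros w; ring.
Qed.

Lemma differentiable_id (z : C) : differentiable_at (fun w => w) z.
Proof.
  apply factors_at_differentiable with (fun _ => 1);
    apply factors_at_global.
  - apply continuous_Cconst.
  - intros w; ring.
Qed.

Lemma differentiable_mult (f g : C -> C) (z : C) :
  differentiable_at f z -> differentiable_at g z ->
  differentiable_at (fun w => f w * g w) z.
Proof.
  intros Hf Hg; assert (Cg := differentiable_continuous _ _ Hg).
  apply slope_factors in Hf; apply slope_factors in Hg.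
  apply factors_at_differentiable with (fun w => slope f z w * g w + f z * slope g z w);
    apply factors_at_global.
  - apply continuous_Cplus; apply continuous_Cmult; auto using continuous_Cconst.
    apply Hf. apply Hg.
  - intros w; rewrite (slope_eq f z w) at 1.
    transitivity (f z * g w + (w - z) * (slope f z w * g w)); [ring|].
    rewrite (slope_eq g z w) at 1; ring.
Qed.

Lemma differentiable_minus (f g : C -> C) (z : C) :
  differentiable_at f z -> differentiable_at g z ->
  differentiable_at (fun w => f w - g w) z.
Proof.
  intros Hf Hg; apply slope_factors in Hf; apply slope_factors in Hg.
  apply factors_at_differentiable with (fun w => slope f z w - slope g z w);
    apply factors_at_global.
  - apply continuous_Cminus; [apply Hf|apply Hg].
  - intros w; rewrite (slope_eq f z w), (slope_eq g z w); ring.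
Qed.

Lemma continuous_neq0 (f : C -> C) (z : C) :
  continuous (T := C_UniformSpace) (U := C_UniformSpace) f z -> f z <> 0 ->
  locally (T := C_UniformSpace) z (fun w => f w <> 0).
Proof.
  intros Hf H; rewrite continuous_Cmod in Hf.
  assert (Hp : (0 < Cmod (f z))%R) by (apply Cmod_gt_0; exact H).
  generalize (Hf _ Hp); apply filter_imp; intros w Hw E; rewrite E in Hw.
  replace (0 - f z) with (- f z) in Hw by ring; rewrite Cmod_opp in Hw; lra.
Qed.

Lemma differentiable_inv (f : C -> C) (z : C) :
  differentiable_at f z -> f z <> 0 -> differentiable_at (fun w => / f w) z.
Proof.
  intros Hf H; assert (Cf := differentiable_continuous _ _ Hf).
  apply slope_factors in Hf.
  apply factors_at_differentiable with (fun w => - slope f z w / (f w * f z)); split.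
  - apply continuous_Cdiv.
    + apply continuous_Copp, Hf.
    + apply continuous_Cmult; [exact Cf|apply continuous_Cconst].
    + apply Cmult_neq_0; exact H.
  - generalize (continuous_neq0 f z Cf H); apply filter_imp; intros w Hw.
    transitivity (/ f z + (f z - f w) / (f w * f z)).
    + field; auto.
    + rewrite (slope_eq f z w) at 1; field; auto.
Qed.

Lemma differentiable_div (f g : C -> C) (z : C) :
  differentiable_at f z -> differentiable_at g z -> g z <> 0 ->
  differentiable_at (fun w => f w / g w) z.
Proof.
  intros Hf Hg H; apply differentiable_mult; [|apply differentiable_inv]; assumption.
Qed.

(** * Integrals along arcs *)

Lemma scal_R_C (r : R) (z : C) : scal (V := C_R_NormedModule) r z = RtoC r * z.
Proof.
  destruct z as [u v]; unfold Cmult, RtoC; simpl.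
  apply injective_projections; simpl; unfold scal; simpl; unfold mult; simpl; ring.
Qed.

Lemma is_derive_R_C (g : R -> C) (t : R) (l : C) :
  is_derive (V := C_R_NormedModule) g t l <->
  forall eps : R, (0 < eps)%R ->
    locally t (fun s => (Cmod (g s - g t - RtoC (s - t) * l) <= eps * Rabs (s - t))%R).
Proof.
  split.
  - intros [_ H] eps Heps.
    refine (filter_imp _ _ _ (H t (fun P HP => HP) (mkposreal eps Heps))).
    intros s Hs.
    rewrite <- scal_R_C, Cmod_norm; exact Hs.
  - intros H; split; [apply is_linear_scal_l|].
    intros x Hx; replace x with t by exact (is_filter_lim_locally_unique _ _ Hx).
    intros eps; refine (filter_imp _ _ _ (H eps (cond_pos eps))).
    intros s Hs; rewrite <- scal_R_C, Cmod_norm in Hs; exact Hs.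
Qed.

Lemma is_derive_R_C_continuous (g : R -> C) (t : R) (l : C) :
  is_derive (V := C_R_NormedModule) g t l -> continuous (U := C_UniformSpace) g t.
Proof.
  intros H; exact (ex_derive_continuous (V := C_R_NormedModule) g t (ex_intro _ l H)).
Qed.

(** The increment of Q along g is that of g times a slope S tending to l. The error splits into the
    first-order error of g times S, and (s - t) dg (S - l). *)
Lemma is_derive_comp_C (Q : C -> C) (g : R -> C) (t : R) (l dg : C) :
  is_derive (K := C_AbsRing) (V := C_NormedModule) Q (g t) l ->
  is_derive (V := C_R_NormedModule) g t dg ->
  is_derive (V := C_R_NormedModule) (fun s => Q (g s)) t (l * dg).
Proof.
  intros HQ Hg.
  assert (Hs : factors_at Q (g t) (slope Q (g t))) by (apply slope_factors; exists l; exact HQ).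
  assert (E : slope Q (g t) (g t) = l) by (rewrite slope_diag; apply is_C_derive_unique, HQ).
  assert (Hc : continuous (U := C_UniformSpace) (fun s => slope Q (g t) (g s)) t).
  { apply (continuous_comp g (slope Q (g t))); [|apply Hs].
    eapply is_derive_R_C_continuous, Hg. }
  rewrite is_derive_R_C in Hg |- *.
  rewrite continuous_Cmod in Hc.
  intros eps Heps.
  set (A := Cmod l); set (B := Cmod dg).
  assert (HA : (0 <= A)%R) by apply Cmod_ge_0.
  assert (HB : (0 <= B)%R) by apply Cmod_ge_0.
  set (e := Rmin 1 (eps / (A + B + 2))).
  assert (He : (0 < e)%R).
  { apply Rmin_pos; [lra|apply Rdiv_lt_0_compat; lra]. }
  assert (He1 : (e <= 1)%R) by apply Rmin_l.
  assert (He2 : (e * (A + B + 2) <= eps)%R).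
  { replace eps with (eps / (A + B + 2) * (A + B + 2))%R by (field; lra).
    apply Rmult_le_compat_r; [lra|apply Rmin_r]. }
  generalize (filter_and _ _ (Hg e He) (Hc e He)); apply filter_imp.
  intros s [H1 H2]; rewrite E in H2.
  rewrite (slope_eq Q (g t) (g s)).
  set (S := slope Q (g t) (g s)) in *.
  replace (Q (g t) + (g s - g t) * S - Q (g t) - (s - t)%R * (l * dg))
    with ((g s - g t - (s - t)%R * dg) * ((S - l) + l) + (s - t)%R * (dg * (S - l))) by ring.
  eapply Rle_trans; [apply Cmod_triangle|].
  rewrite !Cmod_mult, Cmod_R; fold B.
  assert (H3 := Cmod_triangle (S - l) l); fold A in H3.
  set (X := Cmod (g s - g t - (s - t)%R * dg)) in *.
  assert (HX : (0 <= X)%R) by apply Cmod_ge_0.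
  assert (Hr := Rabs_pos (s - t)); set (r := Rabs (s - t)) in *.
  assert (H4 := Cmod_ge_0 (S - l)).
  assert (H5 : (X * Cmod (S - l + l) <= e * r * (1 + A))%R).
  { apply Rmult_le_compat; try assumption; [apply Cmod_ge_0|lra]. }
  assert (H6 : (r * (B * Cmod (S - l)) <= r * (B * e))%R).
  { apply Rmult_le_compat_l; [exact Hr|]. apply Rmult_le_compat_l; lra. }
  assert (H7 : (r * (e * (A + B + 2)) <= r * eps)%R) by (apply Rmult_le_compat_l; assumption).
  nra.
Qed.

Notation CRInt := (RInt (V := C_R_CompleteNormedModule)).
Notation ex_CRInt := (ex_RInt (V := C_R_CompleteNormedModule)).

Lemma ex_CRInt_continuous (f : R -> C) (a b : R) :
  (a <= b)%R ->
  (forall t, (a <= t <= b)%R -> continuous (U := C_UniformSpace) f t) -> ex_CRInt f a b.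
Proof.
  intros Hab H; apply (ex_RInt_continuous (V := C_R_CompleteNormedModule)).
  intros t; rewrite Rmin_left, Rmax_right by exact Hab; apply H.
Qed.

Lemma CRInt_ext (f g : R -> C) (a b : R) :
  (forall t, (Rmin a b < t < Rmax a b)%R -> f t = g t) -> CRInt f a b = CRInt g a b.
Proof. exact (RInt_ext (V := C_R_CompleteNormedModule) f g a b). Qed.

Lemma CRInt_plus (f g : R -> C) (a b : R) :
  ex_CRInt f a b -> ex_CRInt g a b ->
  CRInt (fun t => f t + g t) a b = CRInt f a b + CRInt g a b.
Proof. intros Hf Hg; exact (RInt_plus (V := C_R_CompleteNormedModule) f g a b Hf Hg). Qed.

(** The values are integrated as a real vector space, so a complex factor is checked on real and
    imaginary parts. *)
Lemma is_RInt_Cmult (f : R -> C) (k : C) (a b : R) (l : C) :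
  is_RInt (V := C_R_NormedModule) f a b l ->
  is_RInt (V := C_R_NormedModule) (fun t => k * f t) a b (k * l).
Proof.
  intros H.
  assert (H1 := is_RInt_fct_extend_fst _ _ _ _ H).
  assert (H2 := is_RInt_fct_extend_snd _ _ _ _ H).
  apply is_RInt_fct_extend_pair; simpl.
  - apply (is_RInt_minus (V := R_NormedModule));
      apply (is_RInt_scal (V := R_NormedModule)); assumption.
  - apply (is_RInt_plus (V := R_NormedModule));
      apply (is_RInt_scal (V := R_NormedModule)); assumption.
Qed.

Lemma ex_CRInt_Cmult (f : R -> C) (k : C) (a b : R) :
  ex_CRInt f a b -> ex_CRInt (fun t => k * f t) a b.
Proof. intros [l H]; exists (k * l); apply is_RInt_Cmult, H. Qed.

Lemma CRInt_Cmult (f : R -> C) (k : C) (a b : R) :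
  ex_CRInt f a b -> CRInt (fun t => k * f t) a b = k * CRInt f a b.
Proof.
  intros H; apply is_RInt_unique, is_RInt_Cmult, (RInt_correct (V := C_R_CompleteNormedModule)), H.
Qed.

Lemma CRInt_bound (f : R -> C) (a b B : R) :
  (a <= b)%R -> ex_CRInt f a b -> (forall t, (a <= t <= b)%R -> (Cmod (f t) <= B)%R) ->
  (Cmod (CRInt f a b) <= (b - a) * B)%R.
Proof.
  intros Hab Hf HB; rewrite Cmod_norm.
  apply (norm_RInt_le_const (V := C_R_NormedModule) f a b).
  - exact Hab.
  - intros t Ht; rewrite <- Cmod_norm; apply HB, Ht.
  - apply (RInt_correct (V := C_R_CompleteNormedModule)), Hf.
Qed.

Lemma CRInt_Chasles (f : R -> C) (a b c : R) :
  ex_CRInt f a b -> ex_CRInt f b c -> CRInt f a c = CRInt f a b + CRInt f b c.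
Proof.
  intros H1 H2; symmetry; exact (RInt_Chasles (V := C_R_CompleteNormedModule) f a b c H1 H2).
Qed.

Lemma bounded_continuous_C (f : R -> C) (a b : R) :
  (forall t, (a <= t <= b)%R -> continuous (U := C_UniformSpace) f t) ->
  exists B : R, forall t, (a <= t <= b)%R -> (Cmod (f t) <= B)%R.
Proof.
  intros H.
  destruct (bounded_continuity (V := C_R_NormedModule) f a b H) as [B HB].
  exists B; intros t Ht; rewrite Cmod_norm; left; apply HB, Ht.
Qed.

(** Both conditions are two-sided even at [a] and [b], so that arcs restrict to subintervals and the
    chain rule involves no relative filters. Pieces of paths, differentiable only relative to their
    interval, are brought to this form by extension. *)
Definition C1_arc (zeta dzeta : R -> C) (a b : R) : Prop :=
  forall t, (a <= t <= b)%R ->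
    is_derive (V := C_R_NormedModule) zeta t (dzeta t) /\
    continuous (U := C_UniformSpace) dzeta t.

Definition arc_integral (zeta dzeta : R -> C) (a b : R) (F : C -> C) : C :=
  CRInt (fun t => F (zeta t) * dzeta t) a b.

Definition arc_trace (zeta : R -> C) (a b : R) (z : C) : Prop :=
  exists t, (a <= t <= b)%R /\ zeta t = z.

(** Continuity in the plane at each point of K, stronger than continuity of the restriction to K; it
    composes directly with arcs. *)
Definition continuous_along (K : C -> Prop) (F : C -> C) : Prop :=
  forall z, K z -> continuous (T := C_UniformSpace) (U := C_UniformSpace) F z.

Lemma arc_continuous (zeta dzeta : R -> C) (a b : R) (F : C -> C) :
  C1_arc zeta dzeta a b -> continuous_along (arc_trace zeta a b) F ->
  forall t, (a <= t <= b)%R -> continuous (U := C_UniformSpace) (fun t => F (zeta t)) t.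
Proof.
  intros Hz HF t Ht.
  apply (continuous_comp zeta F).
  - eapply is_derive_R_C_continuous, Hz, Ht.
  - apply HF; exists t; auto.
Qed.

Lemma ex_arc_integral (zeta dzeta : R -> C) (a b : R) (F : C -> C) :
  (a <= b)%R -> C1_arc zeta dzeta a b -> continuous_along (arc_trace zeta a b) F ->
  ex_CRInt (fun t => F (zeta t) * dzeta t) a b.
Proof.
  intros Hab Hz HF; apply ex_CRInt_continuous; [exact Hab|].
  intros t Ht; apply continuous_Cmult.
  - eapply arc_continuous; eassumption.
  - apply Hz, Ht.
Qed.

Lemma arc_integral_primitive (zeta dzeta : R -> C) (a b : R) (Q q : C -> C) :
  (a <= b)%R -> C1_arc zeta dzeta a b ->
  (forall z, arc_trace zeta a b z ->
     is_derive (K := C_AbsRing) (V := C_NormedModule) Q z (q z)) ->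
  continuous_along (arc_trace zeta a b) q ->
  arc_integral zeta dzeta a b q = Q (zeta b) - Q (zeta a).
Proof.
  intros Hab Hz HQ Hq; apply (is_RInt_unique (V := C_R_CompleteNormedModule)).
  apply (is_RInt_derive (V := C_R_CompleteNormedModule) (fun t => Q (zeta t)));
    intros t; rewrite Rmin_left, Rmax_right by exact Hab; intros Ht.
  - apply is_derive_comp_C; [apply HQ; exists t; auto|apply Hz, Ht].
  - apply (continuous_Cmult (fun t => q (zeta t))).
    + eapply arc_continuous; eassumption.
    + apply Hz, Ht.
Qed.

Lemma arc_integral_bound (zeta dzeta : R -> C) (a b : R) (F : C -> C) (B M : R) :
  (a <= b)%R -> C1_arc zeta dzeta a b -> continuous_along (arc_trace zeta a b) F ->
  (forall t, (a <= t <= b)%R -> (Cmod (dzeta t) <= M)%R) ->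
  (forall t, (a <= t <= b)%R -> (Cmod (F (zeta t)) <= B)%R) ->
  (Cmod (arc_integral zeta dzeta a b F) <= (b - a) * (B * M))%R.
Proof.
  intros Hab Hz HF HM HB; apply CRInt_bound; [exact Hab|eapply ex_arc_integral; eassumption|].
  intros t Ht; rewrite Cmod_mult.
  apply Rmult_le_compat; auto using Cmod_ge_0.
Qed.

Lemma arc_integral_lin (zeta dzeta : R -> C) (a b : R) (F G : C -> C) (k : C) :
  (a <= b)%R -> C1_arc zeta dzeta a b ->
  continuous_along (arc_trace zeta a b) F -> continuous_along (arc_trace zeta a b) G ->
  arc_integral zeta dzeta a b (fun z => F z + k * G z)
  = arc_integral zeta dzeta a b F + k * arc_integral zeta dzeta a b G.
Proof.
  intros Hab Hz HF HG; unfold arc_integral.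
  assert (EF := ex_arc_integral zeta dzeta a b F Hab Hz HF).
  assert (EG := ex_arc_integral zeta dzeta a b G Hab Hz HG).
  transitivity (CRInt (fun t => F (zeta t) * dzeta t + k * (G (zeta t) * dzeta t)) a b).
  - apply CRInt_ext; intros t _; ring.
  - rewrite (CRInt_plus (fun t => F (zeta t) * dzeta t) (fun t => k * (G (zeta t) * dzeta t)));
      [|exact EF|apply ex_CRInt_Cmult, EG].
    f_equal; apply (CRInt_Cmult (fun t => G (zeta t) * dzeta t)), EG.
Qed.

(* [int_compact] stands for the compactness of K: applied to 1 / (z - w), it
   bounds the distance from K to a point w outside K below. *)
Record integral_on (K : C -> Prop) (L : (C -> C) -> C) : Prop := {
  int_lin : forall F G k, continuous_along K F -> continuous_along K G ->
    L (fun z => F z + k * G z) = L F + k * L G;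
  int_bound : exists M : R, (0 <= M)%R /\ forall F B, (0 <= B)%R ->
    continuous_along K F -> (forall z, K z -> (Cmod (F z) <= B)%R) ->
    (Cmod (L F) <= M * B)%R;
  int_compact : forall F, continuous_along K F ->
    exists B : R, (0 <= B)%R /\ forall z, K z -> (Cmod (F z) <= B)%R
}.

Lemma arc_integral_on (zeta dzeta : R -> C) (a b : R) :
  (a <= b)%R -> C1_arc zeta dzeta a b ->
  integral_on (arc_trace zeta a b) (arc_integral zeta dzeta a b).
Proof.
  intros Hab Hz; split.
  - intros F G k; apply arc_integral_lin; assumption.
  - destruct (bounded_continuous_C dzeta a b) as [M HM].
    { intros t Ht; apply Hz, Ht. }
    assert (HM0 : (0 <= M)%R).
    { eapply Rle_trans; [apply Cmod_ge_0|apply (HM a); lra]. }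
    exists ((b - a) * M)%R; split; [apply Rmult_le_pos; lra|].
    intros F B HB HF H.
    replace ((b - a) * M * B)%R with ((b - a) * (B * M))%R by ring.
    apply arc_integral_bound; auto.
    intros t Ht; apply H; exists t; auto.
  - intros F HF.
    destruct (bounded_continuous_C (fun t => F (zeta t)) a b) as [B HB].
    { intros t Ht; eapply arc_continuous; eassumption. }
    exists B; split.
    + eapply Rle_trans; [apply Cmod_ge_0|apply (HB a); lra].
    + intros z [t [Ht <-]]; auto.
Qed.

(** * Cauchy transforms *)

Create HintDb ccont.
#[local] Hint Resolve continuous_Cplus continuous_Cminus continuous_Copp continuous_Cmult
  continuous_Cconst continuous_Cid continuous_Cdiv continuous_Cinv Cmult_neq_0
  Cminus_eq_contra : ccont.

Lemma Cmod_minus_sym (z w : C) : Cmod (z - w) = Cmod (w - z).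
Proof. rewrite <- Cmod_opp; f_equal; ring. Qed.

Lemma Cmod_triangle_minus (x y z : C) : (Cmod (x - z) <= Cmod (x - y) + Cmod (y - z))%R.
Proof. replace (x - z) with ((x - y) + (y - z)) by ring; apply Cmod_triangle. Qed.

(** This is the bound of [integral_on] with B = 0. It is the only link between the arbitrary
    functional L and the values on K, and the source of [int_ext]. *)
Lemma int_zero (K : C -> Prop) (L : (C -> C) -> C) (F : C -> C) :
  integral_on K L -> continuous_along K F -> (forall z, K z -> F z = 0) -> L F = 0.
Proof.
  intros HL HF H; destruct (int_bound _ _ HL) as [M [_ HM]].
  apply Cmod_eq_0, Rle_antisym; [|apply Cmod_ge_0].
  rewrite <- (Rmult_0_r M); apply HM; [lra|exact HF|].
  intros z Hz; rewrite H, Cmod_0 by exact Hz; lra.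
Qed.

Lemma int_minus (K : C -> Prop) (L : (C -> C) -> C) (F G : C -> C) :
  integral_on K L -> continuous_along K F -> continuous_along K G ->
  L F - L G = L (fun z => F z + (- (1)) * G z).
Proof. intros HL HF HG; rewrite (int_lin _ _ HL) by assumption; ring. Qed.

Lemma int_ext (K : C -> Prop) (L : (C -> C) -> C) (F G : C -> C) :
  integral_on K L -> continuous_along K F -> continuous_along K G ->
  (forall z, K z -> F z = G z) -> L F = L G.
Proof.
  intros HL HF HG H.
  assert (E : L F - L G = 0).
  { rewrite (int_minus _ _ _ _ HL HF HG).
    apply (int_zero _ _ _ HL).
    - intros z Hz; auto with ccont.
    - intros z Hz; rewrite H by exact Hz; ring. }
  replace (L F) with (L F - L G + L G) by ring; rewrite E; ring.
Qed.

Lemma int_scal (K : C -> Prop) (L : (C -> C) -> C) (F : C -> C) (k : C) :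
  integral_on K L -> continuous_along K F -> L (fun z => k * F z) = k * L F.
Proof.
  intros HL HF.
  assert (C0 : continuous_along K (fun _ => 0)) by (intros z Hz; apply continuous_Cconst).
  transitivity (L (fun z => 0 + k * F z)).
  - apply (int_ext K); auto; try (intros z Hz; auto with ccont); ring.
  - rewrite (int_lin _ _ HL) by assumption.
    rewrite (int_zero _ _ _ HL C0) by auto; ring.
Qed.

Lemma int_far (K : C -> Prop) (L : (C -> C) -> C) (w : C) :
  integral_on K L -> ~ K w ->
  exists d : R, (0 < d)%R /\ forall z, K z -> (d <= Cmod (z - w))%R.
Proof.
  intros HL Hw.
  assert (Hn : forall z, K z -> z - w <> 0).
  { intros z Hz; apply Cminus_eq_contra; intros ->; auto. }
  destruct (int_compact _ _ HL (fun z => / (z - w))) as [B [HB H]].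
  { intros z Hz; auto with ccont. }
  (* The added 1 guards against B = 0, which occurs when K is empty. *)
  exists (/ (B + 1))%R; split; [apply Rinv_0_lt_compat; lra|].
  intros z Hz; specialize (H z Hz); specialize (Hn z Hz).
  rewrite Cmod_inv in H by exact Hn.
  apply Cmod_gt_0 in Hn.
  rewrite <- (Rinv_inv (Cmod (z - w))).
  apply Rinv_le_contravar; [apply Rinv_0_lt_compat; exact Hn|lra].
Qed.

Lemma int_off_locally (K : C -> Prop) (L : (C -> C) -> C) (w : C) :
  integral_on K L -> ~ K w -> locally (T := C_UniformSpace) w (fun w' => ~ K w').
Proof.
  intros HL Hw; destruct (int_far _ _ _ HL Hw) as [d [Hd H]].
  apply locally_Cmod; exists d; split; [exact Hd|].
  intros w' Hw' HK; specialize (H w' HK); lra.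
Qed.

Lemma off_neq (K : C -> Prop) (z w : C) : ~ K w -> K z -> z - w <> 0.
Proof. intros Hw Hz; apply Cminus_eq_contra; intros ->; auto. Qed.
#[local] Hint Resolve off_neq : ccont.

(** Resolvent identity: 1/(z - v) - 1/(z - w) = (v - w) / ((z - w)(z - v)). The difference quotient
    of a Cauchy transform is again a Cauchy transform, with density F z / (z - w), so that
    continuity alone yields differentiability. *)
Lemma kernel_slope (K : C -> Prop) (L : (C -> C) -> C) (F : C -> C) (w v : C) :
  integral_on K L -> continuous_along K F -> ~ K w -> ~ K v ->
  L (fun z => F z / (z - v)) - L (fun z => F z / (z - w))
  = (v - w) * L (fun z => F z / (z - w) / (z - v)).
Proof.
  intros HL HF Hw Hv.
  assert (C1 : continuous_along K (fun z => F z / (z - w) / (z - v))).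
  { intros z Hz; assert (Cz := HF z Hz); eauto 8 with ccont. }
  assert (C2 : forall u, ~ K u -> continuous_along K (fun z => F z / (z - u))).
  { intros u Hu z Hz; assert (Cz := HF z Hz); eauto 8 with ccont. }
  rewrite (int_minus _ _ _ _ HL) by auto.
  rewrite <- (int_scal _ _ _ _ HL C1).
  apply (int_ext K); auto.
  - intros z Hz; apply continuous_Cplus, continuous_Cmult; auto with ccont; apply C2; auto.
  - intros z Hz; auto with ccont.
  - intros z Hz; field; split; eapply off_neq; eassumption.
Qed.

Lemma kernel_continuous (K : C -> Prop) (L : (C -> C) -> C) (F : C -> C) (w : C) :
  integral_on K L -> continuous_along K F -> ~ K w ->
  continuous (T := C_UniformSpace) (U := C_UniformSpace)
    (fun v => L (fun z => F z / (z - v))) w.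
Proof.
  intros HL HF Hw; apply continuous_C_at; intros eps Heps.
  destruct (int_far _ _ _ HL Hw) as [d [Hd Hfar]].
  destruct (int_bound _ _ HL) as [M [HM0 HM]].
  destruct (int_compact _ _ HL F HF) as [B [HB0 HB]].
  (* Bound for the Cauchy transform in [kernel_slope]: on K one has |z - w| >= d, and |z - v| >= d/2
     once |v - w| < d/2. The added 1 makes D positive. *)
  set (D := (M * (B / d / (d / 2)) + 1)%R).
  assert (HD0 : (0 <= B / d / (d / 2))%R) by (repeat apply Rdiv_le_0_compat; lra).
  assert (HD : (0 < D)%R) by (unfold D; nra).
  exists (Rmin (d / 2) (eps / D)); split.
  { apply Rmin_pos; [lra|apply Rdiv_lt_0_compat; assumption]. }
  intros v Hv.
  assert (Hv1 := Rlt_le_trans _ _ _ Hv (Rmin_l _ _)).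
  assert (Hv2 := Rlt_le_trans _ _ _ Hv (Rmin_r _ _)).
  assert (Hfv : forall z, K z -> (d / 2 <= Cmod (z - v))%R).
  { intros z Hz; specialize (Hfar z Hz).
    assert (H := Cmod_triangle_minus z v w); lra. }
  assert (Hvn : ~ K v).
  { intros Hk; specialize (Hfv v Hk); replace (v - v) with (RtoC 0) in Hfv by ring.
    rewrite Cmod_0 in Hfv; lra. }
  rewrite (kernel_slope K) by assumption.
  rewrite Cmod_mult.
  assert (H : (Cmod (L (fun z => F z / (z - w) / (z - v))%C) <= M * (B / d / (d / 2)))%R).
  { apply HM; [exact HD0| |].
    - intros z Hz; assert (Cz := HF z Hz); eauto 8 with ccont.
    - intros z Hz.
      rewrite !Cmod_div by (eapply off_neq; eassumption).
      apply Rmult_le_compat.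
      + apply Rdiv_le_0_compat; [apply Cmod_ge_0|].
        specialize (Hfar z Hz); lra.
      + left; apply Rinv_0_lt_compat; specialize (Hfv z Hz); lra.
      + apply Rmult_le_compat; [apply Cmod_ge_0| |apply HB, Hz|].
        * left; apply Rinv_0_lt_compat; specialize (Hfar z Hz); lra.
        * apply Rinv_le_contravar; auto.
      + apply Rinv_le_contravar; [lra|auto]. }
  apply Rle_lt_trans with (Cmod (v - w) * D)%R.
  - apply Rmult_le_compat_l; [apply Cmod_ge_0|unfold D; lra].
  - replace eps with (eps / D * D)%R by (field; lra).
    apply Rmult_lt_compat_r; assumption.
Qed.

Lemma kernel_factors (K : C -> Prop) (L : (C -> C) -> C) (F : C -> C) (w : C) :
  integral_on K L -> continuous_along K F -> ~ K w ->
  factors_at (fun v => L (fun z => F z / (z - v))) w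
    (fun v => L (fun z => F z / (z - w) / (z - v))).
Proof.
  intros HL HF Hw; split.
  - apply (kernel_continuous K L (fun z => F z / (z - w))); auto.
    intros z Hz; assert (Cz := HF z Hz); eauto with ccont.
  - refine (filter_imp _ _ _ (int_off_locally _ _ _ HL Hw)); intros v Hv.
    rewrite <- (kernel_slope K) by assumption.
    C_eq; ring.
Qed.

Lemma kernel_differentiable (K : C -> Prop) (L : (C -> C) -> C) (F : C -> C) (w : C) :
  integral_on K L -> continuous_along K F -> ~ K w ->
  differentiable_at (fun v => L (fun z => F z / (z - v))) w.
Proof.
  intros HL HF Hw; eapply factors_at_differentiable, kernel_factors; eassumption.
Qed.

(* The only trace of closedness needed: the index w |-> L (1 / (z - w)) has
   derivative 0 off K. *)
Definition double_pole_free (K : C -> Prop) (L : (C -> C) -> C) : Prop :=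
  forall w, ~ K w -> L (fun z => 1 / (z - w) / (z - w)) = 0.

Lemma is_derive_segment (w v : C) (s : R) :
  is_derive (V := C_R_NormedModule) (fun s : R => w + s * (v - w)) s (v - w).
Proof.
  apply is_derive_R_C; intros eps Heps; apply filter_forall; intros t.
  replace (w + t * (v - w) - (w + s * (v - w)) - (t - s)%R * (v - w)) with (RtoC 0)
    by (rewrite RtoC_minus; ring).
  rewrite Cmod_0; apply Rmult_le_pos; [lra|apply Rabs_pos].
Qed.

(** With density 1, [kernel_factors] gives the double-pole integral as derivative of the index.
    Segments suffice below (radii of circles, small discs, rays to infinity), which avoids connected
    components. *)
Lemma index_constant_on_segment (K : C -> Prop) (L : (C -> C) -> C) (w v : C) :
  integral_on K L -> double_pole_free K L ->
  (forall s : R, (0 <= s <= 1)%R -> ~ K (w + s * (v - w))) ->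
  L (fun z => 1 / (z - w)) = L (fun z => 1 / (z - v)).
Proof.
  intros HL HD Hseg.
  set (J := fun u => L (fun z => 1 / (z - u))).
  assert (H : J (w + 0%R * (v - w)) = J (w + 1%R * (v - w))).
  { apply (eq_is_derive (V := C_R_NormedModule) (fun s : R => J (w + s * (v - w)))); [|lra].
    intros s Hs.
    change (is_derive (V := C_R_NormedModule) (fun s : R => J (w + s * (v - w))) s (RtoC 0)).
    rewrite <- (Cmult_0_l (v - w)).
    apply (is_derive_comp_C J (fun s : R => w + s * (v - w))); [|apply is_derive_segment].
    rewrite <- (HD _ (Hseg s Hs)).
    refine (factors_at_is_derive _ _ _ (kernel_factors K L (fun _ => 1) _ HL _ (Hseg s Hs))).
    intros z Hz; auto with ccont. }
  unfold J in H.
  replace (w + 0%R * (v - w)) with w in H by ring.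
  replace (w + 1%R * (v - w)) with v in H by ring.
  exact H.
Qed.

(** * Goursat's lemma *)

Record rectangle := Rectangle { lo_s : R; hi_s : R; lo_t : R; hi_t : R }.

Definition on_rectangle (mu : R -> R -> R -> R -> C) (r : rectangle) : C :=
  mu (lo_s r) (hi_s r) (lo_t r) (hi_t r).

Definition sub_rectangle (r r' : rectangle) : Prop :=
  (lo_s r' <= lo_s r)%R /\ (lo_s r <= hi_s r)%R /\ (hi_s r <= hi_s r')%R /\
  (lo_t r' <= lo_t r)%R /\ (lo_t r <= hi_t r)%R /\ (hi_t r <= hi_t r')%R.

Definition additive_on (mu : R -> R -> R -> R -> C) (r : rectangle) : Prop :=
  (forall a m b c d, (a <= m <= b)%R -> sub_rectangle (Rectangle a b c d) r ->
     mu a b c d = mu a m c d + mu m b c d) /\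
  (forall a b c m d, (c <= m <= d)%R -> sub_rectangle (Rectangle a b c d) r ->
     mu a b c d = mu a b c m + mu a b m d).

(** A decidable test makes the selection a function, which can be iterated without choice. [r4] is
    the default: when the other three tests fail, the triangle inequality forces it to carry enough
    of mu. *)
Definition quarter (mu : R -> R -> R -> R -> C) (r : rectangle) : rectangle :=
  let m := ((lo_s r + hi_s r) / 2)%R in
  let l := ((lo_t r + hi_t r) / 2)%R in
  let r1 := Rectangle (lo_s r) m (lo_t r) l in
  let r2 := Rectangle (lo_s r) m l (hi_t r) in
  let r3 := Rectangle m (hi_s r) (lo_t r) l in
  let r4 := Rectangle m (hi_s r) l (hi_t r) in
  let big r' := Rle_dec (Cmod (on_rectangle mu r)) (4 * Cmod (on_rectangle mu r')) in
  if big r1 then r1 else if big r2 then r2 else if big r3 then r3 else r4.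

Lemma quarter_spec (mu : R -> R -> R -> R -> C) (r0 r : rectangle) :
  additive_on mu r0 -> sub_rectangle r r0 ->
  let r' := quarter mu r in
  sub_rectangle r' r /\ (hi_s r' - lo_s r' = (hi_s r - lo_s r) / 2)%R /\
  (hi_t r' - lo_t r' = (hi_t r - lo_t r) / 2)%R /\
  (Cmod (on_rectangle mu r) <= 4 * Cmod (on_rectangle mu r'))%R.
Proof.
  intros [Hs Ht] Hr; destruct r as [a b c d].
  unfold quarter, on_rectangle; simpl.
  set (m := ((a + b) / 2)%R); set (l := ((c + d) / 2)%R).
  assert (Hm : m = ((a + b) / 2)%R) by reflexivity.
  assert (Hl : l = ((c + d) / 2)%R) by reflexivity.
  clearbody m l; unfold sub_rectangle in *; simpl in *.
  assert (E : mu a b c d = mu a m c l + mu a m l d + (mu m b c l + mu m b l d)).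
  { rewrite (Hs a m b c d), (Ht a m c l d), (Ht m b c l d) by (simpl; lra). reflexivity. }
  assert (H : (Cmod (mu a b c d) <= Cmod (mu a m c l) + Cmod (mu a m l d)
                + (Cmod (mu m b c l) + Cmod (mu m b l d)))%R).
  { rewrite E; eapply Rle_trans; [apply Cmod_triangle|].
    apply Rplus_le_compat; apply Cmod_triangle. }
  repeat match goal with |- context [Rle_dec ?x ?y] => destruct (Rle_dec x y) end;
    simpl; repeat split; lra.
Qed.

Fixpoint bisection (mu : R -> R -> R -> R -> C) (r : rectangle) (n : nat) : rectangle :=
  match n with O => r | S m => quarter mu (bisection mu r m) end.

Lemma sub_rectangle_trans (r1 r2 r3 : rectangle) :
  sub_rectangle r1 r2 -> sub_rectangle r2 r3 -> sub_rectangle r1 r3.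
Proof. unfold sub_rectangle; lra. Qed.

Lemma bisection_spec (mu : R -> R -> R -> R -> C) (r : rectangle) (n : nat) :
  additive_on mu r -> sub_rectangle r r ->
  let r' := bisection mu r n in
  sub_rectangle r' r /\ (hi_s r' - lo_s r' = (hi_s r - lo_s r) / 2 ^ n)%R /\
  (hi_t r' - lo_t r' = (hi_t r - lo_t r) / 2 ^ n)%R /\
  (Cmod (on_rectangle mu r) <= 4 ^ n * Cmod (on_rectangle mu r'))%R.
Proof.
  intros Hmu Hr; induction n as [|n IH]; simpl in *.
  - repeat split; try apply Hr; lra.
  - destruct IH as (H1 & H2 & H3 & H4).
    destruct (quarter_spec mu r _ Hmu H1) as (G1 & G2 & G3 & G4).
    assert (Hp : (0 < 2 ^ n)%R) by (apply pow_lt; lra).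
    assert (Hq : (0 < 4 ^ n)%R) by (apply pow_lt; lra).
    split; [eapply sub_rectangle_trans; eassumption|].
    rewrite G2, G3, H2, H3.
    split; [field; lra|split; [field; lra|]].
    eapply Rle_trans; [exact H4|].
    rewrite (Rmult_comm 4), Rmult_assoc.
    apply Rmult_le_compat_l; lra.
Qed.

Lemma bisection_decr (mu : R -> R -> R -> R -> C) (r : rectangle) (n k : nat) :
  additive_on mu r -> sub_rectangle r r ->
  sub_rectangle (bisection mu r (k + n)) (bisection mu r n).
Proof.
  intros Hmu Hr; induction k as [|k IH]; simpl.
  - destruct (bisection_spec mu r n Hmu Hr) as [H _]; unfold sub_rectangle in *; lra.
  - eapply sub_rectangle_trans; [|exact IH].
    apply (quarter_spec mu r); [exact Hmu|apply bisection_spec; assumption].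
Qed.

Lemma nested_intervals_point (u v : nat -> R) :
  (forall n k, (u n <= u (k + n)%nat)%R /\ (u (k + n)%nat <= v (k + n)%nat)%R /\
     (v (k + n)%nat <= v n)%R) ->
  exists s, forall n, (u n <= s <= v n)%R.
Proof.
  intros H.
  assert (Hub : forall n m, (u n <= v m)%R).
  { intros n m; destruct (H n m) as (H1 & H2 & _), (H m n) as (_ & _ & H3).
    rewrite (Nat.add_comm m n) in *; lra. }
  destruct (completeness (fun x => exists n, x = u n)) as [s [Hs1 Hs2]].
  - exists (v O); intros x [n ->]; apply Hub.
  - exists (u O), O; reflexivity.
  - exists s; intros n; split.
    + apply Hs1; exists n; reflexivity.
    + apply Hs2; intros x [m ->]; apply Hub.
Qed.

Lemma pow2_unbounded (x : R) : exists n : nat, (x < 2 ^ n)%R.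
Proof.
  destruct (INR_unbounded x) as [n Hn]; exists n.
  apply Rlt_le_trans with (INR n); [exact Hn|].
  clear; induction n as [|n IH]; [simpl; lra|].
  rewrite S_INR; simpl.
  assert (1 <= 2 ^ n)%R by (apply pow_R1_Rle; lra); lra.
Qed.

(* Some quarter of each rectangle carries at least a fourth of |mu|; the nested
   quarters shrink to a point, near which |mu| is o(side^2). *)
Lemma additive_locally_small_zero (mu : R -> R -> R -> R -> C) (r : rectangle) :
  additive_on mu r -> sub_rectangle r r ->
  (forall s t, (lo_s r <= s <= hi_s r)%R -> (lo_t r <= t <= hi_t r)%R ->
     forall eps : R, (0 < eps)%R -> exists del : R, (0 < del)%R /\
       forall a b c d, sub_rectangle (Rectangle a b c d) r ->
         (a <= s <= b)%R -> (c <= t <= d)%R -> (b - a < del)%R -> (d - c < del)%R ->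
         (Cmod (mu a b c d) <= eps * (((b - a) + (d - c)) * ((b - a) + (d - c))))%R) ->
  on_rectangle mu r = 0.
Proof.
  intros Hmu Hr Hloc.
  set (q := bisection mu r).
  destruct (nested_intervals_point (fun n => lo_s (q n)) (fun n => hi_s (q n))) as [s Hs].
  { intros n k; destruct (bisection_decr mu r n k Hmu Hr) as (H1 & H2 & H3 & _); auto. }
  destruct (nested_intervals_point (fun n => lo_t (q n)) (fun n => hi_t (q n))) as [t Ht].
  { intros n k; destruct (bisection_decr mu r n k Hmu Hr) as (_ & _ & _ & H1 & H2 & H3); auto. }
  apply Cmod_eq_0, Rle_antisym; [|apply Cmod_ge_0].
  set (X := Cmod (on_rectangle mu r)).
  set (W := ((hi_s r - lo_s r) + (hi_t r - lo_t r))%R).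
  destruct (Rle_lt_dec X 0) as [H0|H0]; [exact H0|exfalso].
  assert (HW : (0 <= W)%R) by (unfold W, sub_rectangle in *; lra).
  (* As 4^n (W / 2^n)^2 = W^2, this choice leads to X <= X W^2 / (W^2 + 1), impossible for X > 0. *)
  assert (Heps : (0 < X / (W * W + 1))%R) by (apply Rdiv_lt_0_compat; nra).
  destruct (Hloc s t (Hs O) (Ht O) _ Heps) as (del & Hdel & Hsmall).
  destruct (pow2_unbounded (W / del)) as [n Hn].
  assert (Hp : (0 < 2 ^ n)%R) by (apply pow_lt; lra).
  assert (Hn' : (W / 2 ^ n < del)%R).
  { apply Rmult_lt_reg_r with (2 ^ n)%R; [exact Hp|].
    replace (W / 2 ^ n * 2 ^ n)%R with (W / del * del)%R by (field; lra).
    rewrite (Rmult_comm del); apply Rmult_lt_compat_r; assumption. }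
  destruct (bisection_spec mu r n Hmu Hr) as (H1 & H2 & H3 & H4).
  fold (q n) in *; specialize (Hs n); specialize (Ht n); simpl in Hs, Ht.
  assert (HE : ((hi_s r - lo_s r) / 2 ^ n + (hi_t r - lo_t r) / 2 ^ n = W / 2 ^ n)%R)
    by (unfold W; field; lra).
  assert (H5 : (0 <= (hi_s r - lo_s r) / 2 ^ n)%R /\ (0 <= (hi_t r - lo_t r) / 2 ^ n)%R).
  { unfold sub_rectangle in Hr; split; apply Rdiv_le_0_compat; lra. }
  specialize (Hsmall (lo_s (q n)) (hi_s (q n)) (lo_t (q n)) (hi_t (q n))).
  assert (H6 := Hsmall H1 Hs Ht ltac:(lra) ltac:(lra)).
  rewrite H2, H3, HE in H6; fold (on_rectangle mu (q n)) in H6.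
  fold X in H4.
  assert (Hq : (4 ^ n = 2 ^ n * 2 ^ n)%R) by (rewrite <- Rpow_mult_distr; f_equal; lra).
  assert (H7 : (X <= X / (W * W + 1) * (W * W))%R).
  { eapply Rle_trans; [exact H4|].
    replace (X / (W * W + 1) * (W * W))%R
      with (4 ^ n * (X / (W * W + 1) * (W / 2 ^ n * (W / 2 ^ n))))%R
      by (rewrite Hq; field; split; [nra|lra]).
    apply Rmult_le_compat_l; [rewrite Hq; nra|exact H6]. }
  assert (H8 : (X / (W * W + 1) * (W * W) = X - X / (W * W + 1))%R) by (field; nra).
  lra.
Qed.

Lemma is_derive_affine (k l z : C) :
  is_derive (K := C_AbsRing) (V := C_NormedModule) (fun v => k + l * v) z l.
Proof.
  apply (factors_at_is_derive (fun v => k + l * v) (fun _ => l)).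
  apply factors_at_global; [apply continuous_Cconst|intros w; ring].
Qed.

Lemma is_derive_quadratic (z0 k l z : C) :
  is_derive (K := C_AbsRing) (V := C_NormedModule)
    (fun v => k * (v - z0) + (/ 2)%R * l * ((v - z0) * (v - z0))) z (k + l * (z - z0)).
Proof.
  (* The half is a coerced real number, opaque to [ring] on C; its doubling is supplied by hand. *)
  assert (E : RtoC (/ 2)%R + RtoC (/ 2)%R = 1)
    by (rewrite <- RtoC_plus; f_equal; field).
  set (q := fun v => k + (/ 2)%R * l * ((v - z0) + (z - z0))).
  replace (k + l * (z - z0)) with (q z).
  - apply factors_at_is_derive, factors_at_global.
    + unfold q; auto 8 with ccont.
    + intros w; unfold q; ring.
  - unfold q.
    transitivity (k + (RtoC (/ 2)%R + RtoC (/ 2)%R) * (l * (z - z0))); [ring|].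
    rewrite E; ring.
Qed.

Lemma is_derive_opp_inv (u z : C) :
  z <> u ->
  is_derive (K := C_AbsRing) (V := C_NormedModule)
    (fun v => - / (v - u)) z (1 / (z - u) / (z - u)).
Proof.
  intros Hz; assert (Hn : z - u <> 0) by (apply Cminus_eq_contra; exact Hz).
  apply (factors_at_is_derive (fun v => - / (v - u)) (fun v => 1 / (z - u) / (v - u))).
  split; [auto with ccont|].
  generalize (continuous_neq0 (fun v => v - u) z ltac:(auto with ccont) Hn).
  apply filter_imp; intros w Hw.
  C_eq.
  field; auto.
Qed.

Lemma C1_arc_sub (zeta dzeta : R -> C) (a b a' b' : R) :
  (a <= a')%R -> (b' <= b)%R -> C1_arc zeta dzeta a b -> C1_arc zeta dzeta a' b'.
Proof. intros Ha Hb H t Ht; apply H; lra. Qed.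

Lemma continuous_along_sub (K K' : C -> Prop) (F : C -> C) :
  (forall z, K' z -> K z) -> continuous_along K F -> continuous_along K' F.
Proof. intros H HF z Hz; apply HF, H, Hz. Qed.

Lemma arc_trace_sub (zeta : R -> C) (a b a' b' : R) :
  (a <= a')%R -> (b' <= b)%R ->
  forall z, arc_trace zeta a' b' z -> arc_trace zeta a b z.
Proof. intros Ha Hb z [t [Ht E]]; exists t; split; [lra|exact E]. Qed.

Lemma arc_integral_Chasles (zeta dzeta : R -> C) (a m b : R) (F : C -> C) :
  (a <= m <= b)%R -> C1_arc zeta dzeta a b -> continuous_along (arc_trace zeta a b) F ->
  arc_integral zeta dzeta a b F = arc_integral zeta dzeta a m F + arc_integral zeta dzeta m b F.
Proof.
  intros Hm Hz HF; apply CRInt_Chasles; apply ex_arc_integral; try lra.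
  - eapply C1_arc_sub; [| |exact Hz]; lra.
  - eapply continuous_along_sub; [|exact HF]; apply arc_trace_sub; lra.
  - eapply C1_arc_sub; [| |exact Hz]; lra.
  - eapply continuous_along_sub; [|exact HF]; apply arc_trace_sub; lra.
Qed.

(** The increment of zeta is the integral of the constant 1 along the arc, since the identity is a
    primitive of 1. *)
Lemma arc_lipschitz (zeta dzeta : R -> C) (a b M : R) :
  C1_arc zeta dzeta a b -> (forall t, (a <= t <= b)%R -> (Cmod (dzeta t) <= M)%R) ->
  forall t t', (a <= t <= b)%R -> (a <= t' <= b)%R ->
  (Cmod (zeta t - zeta t') <= M * Rabs (t - t'))%R.
Proof.
  intros Hz HM.
  assert (H : forall t t', (a <= t)%R -> (t <= t')%R -> (t' <= b)%R ->
            (Cmod (zeta t' - zeta t) <= M * (t' - t))%R).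
  { intros t t' H1 H2 H3.
    assert (Hz' : C1_arc zeta dzeta t t') by (apply (C1_arc_sub _ _ a b); assumption).
    rewrite <- (arc_integral_primitive zeta dzeta t t' (fun z => z) (fun _ => 1) H2 Hz').
    - replace (M * (t' - t))%R with ((t' - t) * (1 * M))%R by ring.
      apply arc_integral_bound; auto.
      + intros z _; apply continuous_Cconst.
      + intros s Hs; apply HM; lra.
      + intros s Hs; rewrite Cmod_1; lra.
    - intros z _; apply (factors_at_is_derive (fun z => z) (fun _ => 1)).
      apply factors_at_global; [apply continuous_Cconst|intros v; ring].
    - intros z _; apply continuous_Cconst. }
  intros t t' Ht Ht'; destruct (Rle_lt_dec t t') as [Hl|Hl].
  - rewrite Cmod_minus_sym, Rabs_left1 by lra.
    replace (- (t - t'))%R with (t' - t)%R by ring; apply H; lra.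
  - rewrite Rabs_pos_eq by lra; apply H; lra.
Qed.

(** Cost of replacing F by a function q with primitive Q. In Goursat's argument q is the tangent of
    F at a point. *)
Lemma arc_integral_near (zeta dzeta : R -> C) (a b M B : R) (F Q q : C -> C) :
  (a <= b)%R -> C1_arc zeta dzeta a b -> continuous_along (arc_trace zeta a b) F ->
  (forall t, (a <= t <= b)%R -> (Cmod (dzeta t) <= M)%R) ->
  (forall z, is_derive (K := C_AbsRing) (V := C_NormedModule) Q z (q z)) ->
  continuous_along (arc_trace zeta a b) q ->
  (forall t, (a <= t <= b)%R -> (Cmod (F (zeta t) - q (zeta t)) <= B)%R) ->
  (Cmod (arc_integral zeta dzeta a b F - (Q (zeta b) - Q (zeta a))) <= (b - a) * (B * M))%R.
Proof.
  intros Hab Hz HF HM HQ Hq HB.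
  rewrite <- (arc_integral_primitive zeta dzeta a b Q q) by auto.
  replace (arc_integral zeta dzeta a b F - arc_integral zeta dzeta a b q)
    with (arc_integral zeta dzeta a b F + (- (1)) * arc_integral zeta dzeta a b q) by ring.
  rewrite <- arc_integral_lin by assumption.
  apply arc_integral_bound; auto.
  - intros z Hz'; auto with ccont.
  - intros t Ht.
    replace (F (zeta t) + - (1) * q (zeta t)) with (F (zeta t) - q (zeta t)) by ring.
    apply HB, Ht.
Qed.

(** The boundary of [a, b] x [c, d], counterclockwise in the parameter plane, is carried over by H;
    [Hs] and [Ht] stand for the partial derivatives of H. *)
Definition boundary_integral (H Hs Ht : R -> R -> C) (F : C -> C) (a b c d : R) : C :=
  arc_integral (fun s => H s c) (fun s => Hs s c) a b F
  + arc_integral (H b) (Ht b) c d F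
  - arc_integral (fun s => H s d) (fun s => Hs s d) a b F
  - arc_integral (H a) (Ht a) c d F.

(** Near a point z0 = H s t, F is its tangent up to e |z - z0|. The tangent has a primitive, so it
    contributes nothing around a small rectangle, and the remaining error is quadratic in the sides.
    Working in parameters lets H wrap a rectangle around an annular region. *)
Lemma goursat (H Hs Ht : R -> R -> C) (r : rectangle) (M : R) (F : C -> C) :
  let inside s t := (lo_s r <= s <= hi_s r)%R /\ (lo_t r <= t <= hi_t r)%R in
  sub_rectangle r r ->
  (forall t, (lo_t r <= t <= hi_t r)%R ->
     C1_arc (fun s => H s t) (fun s => Hs s t) (lo_s r) (hi_s r)) ->
  (forall s, (lo_s r <= s <= hi_s r)%R -> C1_arc (H s) (Ht s) (lo_t r) (hi_t r)) ->
  (forall s t, inside s t -> (Cmod (Hs s t) <= M)%R /\ (Cmod (Ht s t) <= M)%R) ->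
  (forall s t s' t', inside s t -> inside s' t' ->
     (Cmod (H s t - H s' t') <= M * (Rabs (s - s') + Rabs (t - t')))%R) ->
  (forall s t, inside s t -> differentiable_at F (H s t)) ->
  on_rectangle (boundary_integral H Hs Ht F) r = 0.
Proof.
  intros inside Hr HCs HCt HM HL HF.
  assert (Cs : forall a b t, (lo_s r <= a)%R -> (b <= hi_s r)%R ->
            (lo_t r <= t <= hi_t r)%R ->
            C1_arc (fun s => H s t) (fun s => Hs s t) a b /\
            continuous_along (arc_trace (fun s => H s t) a b) F).
  { intros a b t Ha Hb Hti; split.
    - eapply C1_arc_sub; [| |apply HCs, Hti]; lra.
    - intros z [s [Hsi <-]]; apply differentiable_continuous, HF; split; lra. }
  assert (Ct : forall c d s, (lo_t r <= c)%R -> (d <= hi_t r)%R ->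
            (lo_s r <= s <= hi_s r)%R ->
            C1_arc (H s) (Ht s) c d /\ continuous_along (arc_trace (H s) c d) F).
  { intros c d s Hc Hd Hsi; split.
    - eapply C1_arc_sub; [| |apply HCt, Hsi]; lra.
    - intros z [t [Hti <-]]; apply differentiable_continuous, HF; split; lra. }
  apply additive_locally_small_zero; [split| exact Hr|].
  - intros a m b c d Hm (S1 & S2 & S3 & S4 & S5 & S6); simpl in *; unfold boundary_integral.
    rewrite (arc_integral_Chasles (fun s => H s c) _ a m b) by (try apply Cs; lra).
    rewrite (arc_integral_Chasles (fun s => H s d) _ a m b) by (try apply Cs; lra).
    ring.
  - intros a b c m d Hm (S1 & S2 & S3 & S4 & S5 & S6); simpl in *; unfold boundary_integral.
    rewrite (arc_integral_Chasles (H a) _ c m d) by (try apply Ct; lra).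
    rewrite (arc_integral_Chasles (H b) _ c m d) by (try apply Ct; lra).
    ring.
  - intros s t Hsi Hti eps Heps.
    assert (Hin : inside s t) by (split; assumption).
    assert (HM0 : (0 <= M)%R) by (eapply Rle_trans; [apply Cmod_ge_0|apply (HM s t Hin)]).
    destruct (slope_factors F (H s t) (HF s t Hin)) as [Hc _].
    set (z0 := H s t) in *; set (l := slope F z0 z0).
    (* The four sides have parameter length 2w in all, and on them the error is at most e M w with
       speed at most M: the total is 2 e M^2 w^2. *)
    set (e := (eps / (2 * (M * M) + 1))%R).
    assert (He : (0 < e)%R) by (apply Rdiv_lt_0_compat; nra).
    assert (He' : (2 * e * (M * M) <= eps)%R).
    { replace eps with (e * (2 * (M * M) + 1))%R at 1 by (unfold e; field; nra). nra. }
    rewrite continuous_C_at in Hc; destruct (Hc e He) as (d0 & Hd0 & Hnear); fold l in Hnear.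
    (* Then w is below 2 d0 / (2M + 1), so M w < d0 and the Lipschitz bound keeps the image within
       d0 of z0. *)
    exists (d0 / (2 * M + 1))%R; split; [apply Rdiv_lt_0_compat; lra|].
    intros a b c d (S1 & S2 & S3 & S4 & S5 & S6) Hab Hcd Hb Hd; simpl in *.
    set (w := ((b - a) + (d - c))%R).
    assert (Hw : (M * w < d0)%R).
    { assert (Hw : (w <= 2 * (d0 / (2 * M + 1)))%R) by (unfold w; lra).
      assert (E : (d0 = (2 * M + 1) * (d0 / (2 * M + 1)))%R) by (field; lra).
      assert (0 < d0 / (2 * M + 1))%R by (apply Rdiv_lt_0_compat; lra). nra. }
    set (Q := fun v => F z0 * (v - z0) + (/ 2)%R * l * ((v - z0) * (v - z0))).
    set (q := fun v => F z0 + l * (v - z0)).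
    assert (HQ : forall z, is_derive (K := C_AbsRing) (V := C_NormedModule) Q z (q z))
      by (intros z; apply is_derive_quadratic).
    assert (Hq : forall K, continuous_along K q)
      by (intros K z _; unfold q; auto with ccont).
    assert (HB : forall s' t', (a <= s' <= b)%R -> (c <= t' <= d)%R ->
              (Cmod (F (H s' t') - q (H s' t')) <= e * (M * w))%R).
    { intros s' t' Hs' Ht'.
      assert (HD : (Cmod (H s' t' - z0) <= M * w)%R).
      { eapply Rle_trans; [apply HL; [split; lra|exact Hin]|].
        apply Rmult_le_compat_l; [exact HM0|unfold w].
        apply Rplus_le_compat; apply Rabs_le; lra. }
      replace (F (H s' t') - q (H s' t'))
        with ((slope F z0 (H s' t') - l) * (H s' t' - z0)).
      2:{ unfold q; rewrite (slope_eq F z0 (H s' t')); ring. }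
      rewrite Cmod_mult; apply Rmult_le_compat; auto using Cmod_ge_0.
      left; apply Hnear; lra. }
    assert (Es : forall t', (c <= t' <= d)%R ->
              (Cmod (arc_integral (fun s => H s t') (fun s => Hs s t') a b F
                     - (Q (H b t') - Q (H a t'))) <= (b - a) * (e * (M * w) * M))%R).
    { intros t' Ht'; destruct (Cs a b t') as [C1 C2]; try lra.
      apply (arc_integral_near (fun s => H s t') _ a b M (e * (M * w)) F Q q); auto; try lra.
      intros s' Hs'; apply HM; split; lra. }
    assert (Et : forall s', (a <= s' <= b)%R ->
              (Cmod (arc_integral (H s') (Ht s') c d F
                     - (Q (H s' d) - Q (H s' c))) <= (d - c) * (e * (M * w) * M))%R).
    { intros s' Hs'; destruct (Ct c d s') as [C1 C2]; try lra.
      apply (arc_integral_near (H s') _ c d M (e * (M * w)) F Q q); auto; try lra.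
      intros t' Ht'; apply HM; split; lra. }
    assert (E1 := Es c ltac:(lra)); assert (E2 := Es d ltac:(lra)).
    assert (E3 := Et a ltac:(lra)); assert (E4 := Et b ltac:(lra)).
    unfold boundary_integral.
    set (I1 := arc_integral (fun s => H s c) _ a b F) in *.
    set (I2 := arc_integral (fun s => H s d) _ a b F) in *.
    set (I3 := arc_integral (H a) _ c d F) in *.
    set (I4 := arc_integral (H b) _ c d F) in *.
    (* The corner values of Q inserted here cancel around the rectangle. *)
    replace (I1 + I4 - I2 - I3)
      with ((I1 - (Q (H b c) - Q (H a c))) + (I4 - (Q (H b d) - Q (H b c)))
            + (- (I2 - (Q (H b d) - Q (H a d))) + - (I3 - (Q (H a d) - Q (H a c))))) by ring.
    eapply Rle_trans; [apply Cmod_triangle|].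
    eapply Rle_trans; [apply Rplus_le_compat; apply Cmod_triangle|].
    rewrite !Cmod_opp; fold w.
    apply Rle_trans with (2 * e * (M * M) * (w * w))%R.
    + replace (2 * e * (M * M) * (w * w))%R
        with (2 * (b - a) * (e * (M * w) * M) + 2 * (d - c) * (e * (M * w) * M))%R
        by (unfold w; ring).
      lra.
    + apply Rmult_le_compat_r; [nra|exact He'].
Qed.

(** * Cauchy's formula on a circle *)

Definition cis (t : R) : C := (cos t, sin t).

Definition circle (p : C) (r t : R) : C := p + r * cis t.

Definition dcircle (r t : R) : C := r * (Ci * cis t).

Definition circle_trace (p : C) (r : R) : C -> Prop := arc_trace (circle p r) 0 (2 * PI).

Definition circle_integral (p : C) (r : R) : (C -> C) -> C :=
  arc_integral (circle p r) (dcircle r) 0 (2 * PI).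

Lemma Cmod_cis (t : R) : Cmod (cis t) = 1%R.
Proof.
  unfold Cmod, cis; simpl.
  replace (cos t * (cos t * 1) + sin t * (sin t * 1))%R with 1%R; [apply sqrt_1|].
  generalize (sin2_cos2 t); unfold Rsqr; lra.
Qed.

Lemma Cmod_le_abs (z : C) : (Cmod z <= Rabs (fst z) + Rabs (snd z))%R.
Proof.
  destruct z as [u v]; simpl.
  replace (u, v) with (RtoC u + Ci * RtoC v)
    by (apply injective_projections; simpl; ring).
  eapply Rle_trans; [apply Cmod_triangle|].
  rewrite Cmod_mult, Cmod_Ci, !Cmod_R; lra.
Qed.

Lemma is_derive_pair (f g : R -> R) (t l m : R) :
  is_derive f t l -> is_derive g t m ->
  is_derive (V := C_R_NormedModule) (fun s => (f s, g s)) t (l, m).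
Proof.
  intros [_ Hf] [_ Hg]; apply is_derive_R_C; intros eps Heps.
  assert (He : (0 < eps / 2)%R) by lra.
  generalize (filter_and _ _ (Hf t (fun P HP => HP) (mkposreal _ He))
                (Hg t (fun P HP => HP) (mkposreal _ He))).
  apply filter_imp; intros s [H1 H2].
  change (Rabs ((f s - f t) - (s - t) * l) <= eps / 2 * Rabs (s - t))%R in H1.
  change (Rabs ((g s - g t) - (s - t) * m) <= eps / 2 * Rabs (s - t))%R in H2.
  eapply Rle_trans; [apply Cmod_le_abs|]; simpl.
  replace (f s + - f t + - ((s - t) * l - 0 * m))%R with ((f s - f t) - (s - t) * l)%R by ring.
  replace (g s + - g t + - ((s - t) * m + 0 * l))%R with ((g s - g t) - (s - t) * m)%R by ring.
  lra.
Qed.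

Lemma is_derive_cis (t : R) : is_derive (V := C_R_NormedModule) cis t (Ci * cis t).
Proof.
  replace (Ci * cis t) with (- sin t, cos t)%R
    by (apply injective_projections; simpl; ring).
  apply is_derive_pair; [apply is_derive_cos|apply is_derive_sin].
Qed.

Lemma circle_C1 (p : C) (r a b : R) : C1_arc (circle p r) (dcircle r) a b.
Proof.
  intros t _; split.
  - apply (is_derive_comp_C (fun v => p + r * v)); [apply is_derive_affine|apply is_derive_cis].
  - apply continuous_Cmult; [apply continuous_Cconst|].
    apply continuous_Cmult; [apply continuous_Cconst|].
    eapply is_derive_R_C_continuous, is_derive_cis.
Qed.

Lemma two_PI_pos : (0 <= 2 * PI)%R.
Proof. generalize PI_RGT_0; lra. Qed.

Lemma circle_integral_on (p : C) (r : R) :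
  integral_on (circle_trace p r) (circle_integral p r).
Proof. apply arc_integral_on; [apply two_PI_pos|apply circle_C1]. Qed.

Lemma circle_closed (p : C) (r : R) : circle p r (2 * PI) = circle p r 0.
Proof. unfold circle, cis; rewrite cos_2PI, sin_2PI, cos_0, sin_0; reflexivity. Qed.

Lemma Cmod_circle (p : C) (r t : R) : (0 <= r)%R -> Cmod (circle p r t - p) = r.
Proof.
  intros Hr; unfold circle; replace (p + r * cis t - p) with (r * cis t) by ring.
  rewrite Cmod_mult, Cmod_cis, Cmod_R, Rabs_pos_eq; lra.
Qed.

Lemma Cmod_dcircle (r t : R) : (0 <= r)%R -> Cmod (dcircle r t) = r.
Proof.
  intros Hr; unfold dcircle; rewrite !Cmod_mult, Cmod_cis, Cmod_R, Cmod_Ci, Rabs_pos_eq; lra.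
Qed.

Lemma circle_trace_dist (p : C) (r : R) (z : C) :
  (0 <= r)%R -> circle_trace p r z -> Cmod (z - p) = r.
Proof. intros Hr [t [_ <-]]; apply Cmod_circle, Hr. Qed.

Lemma circle_off (p : C) (r : R) (w : C) :
  (Cmod (w - p) < r)%R -> ~ circle_trace p r w.
Proof.
  intros Hw H; assert (Hr := Cmod_ge_0 (w - p)).
  apply circle_trace_dist in H; lra.
Qed.

Lemma circle_integral_bound (p : C) (r : R) (F : C -> C) (B : R) :
  (0 <= r)%R -> continuous_along (circle_trace p r) F ->
  (forall z, circle_trace p r z -> (Cmod (F z) <= B)%R) ->
  (Cmod (circle_integral p r F) <= 2 * PI * (B * r))%R.
Proof.
  intros Hr HF HB; replace (2 * PI)%R with (2 * PI - 0)%R at 1 by ring.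
  apply arc_integral_bound; auto using circle_C1, two_PI_pos.
  - intros t _; rewrite Cmod_dcircle; lra.
  - intros t Ht; apply HB; exists t; auto.
Qed.

(** The primitive is -1/(z - w), so only the end points matter; their contributions telescope over
    successive arcs and cancel on a closed curve. *)
Lemma arc_double_pole_free (zeta dzeta : R -> C) (a b : R) (w : C) :
  (a <= b)%R -> C1_arc zeta dzeta a b -> ~ arc_trace zeta a b w ->
  arc_integral zeta dzeta a b (fun z => 1 / (z - w) / (z - w))
  = / (zeta a - w) - / (zeta b - w).
Proof.
  intros Hab Hz Hw.
  rewrite (arc_integral_primitive zeta dzeta a b (fun z => - / (z - w))); auto.
  - ring.
  - intros z Hz'; apply is_derive_opp_inv; intros ->; auto.
  - intros z Hz'; eauto 8 with ccont.
Qed.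

Lemma circle_double_pole_free (p : C) (r : R) :
  double_pole_free (circle_trace p r) (circle_integral p r).
Proof.
  intros w Hw; unfold circle_integral.
  rewrite arc_double_pole_free; auto using two_PI_pos, circle_C1.
  rewrite circle_closed; ring.
Qed.

Lemma circle_integral_const_density (p : C) (r : R) (F : C -> C) (k : C) :
  (0 < r)%R -> (forall z, circle_trace p r z -> F z = k / (z - p)) ->
  circle_integral p r F = 2 * PI * Ci * k.
Proof.
  intros Hr HF; unfold circle_integral, arc_integral.
  transitivity (CRInt (fun _ => Ci * k) 0 (2 * PI)).
  - apply CRInt_ext; intros t Ht.
    rewrite Rmin_left, Rmax_right in Ht by apply two_PI_pos.
    rewrite HF by (exists t; split; [lra|reflexivity]).
    unfold dcircle, circle.
    assert (H1 : RtoC r <> 0) by (intros E; apply RtoC_inj in E; lra).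
    assert (H2 : cis t <> 0) by (apply Cmod_gt_0; rewrite Cmod_cis; lra).
    field; repeat split; auto.
    replace (p + r * cis t - p) with (r * cis t) by ring; auto with ccont.
  - rewrite (RInt_const (V := C_R_CompleteNormedModule)).
    change (scal (V := C_R_NormedModule) (2 * PI - 0)%R (Ci * k) = 2 * PI * Ci * k).
    rewrite scal_R_C, Rminus_0_r, RtoC_mult; C_eq; ring.
Qed.

(** At the centre dz/(z - p) = i dt on the circle, so the integral is explicit; the other points are
    reached along a radius. *)
Lemma circle_index (p : C) (r : R) (w : C) :
  (Cmod (w - p) < r)%R ->
  circle_integral p r (fun z => 1 / (z - w)) = 2 * PI * Ci.
Proof.
  intros Hw; assert (Hr := Cmod_ge_0 (w - p)).
  rewrite <- (index_constant_on_segment (circle_trace p r) _ p w).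
  - rewrite (circle_integral_const_density p r _ 1); [ring|lra|reflexivity].
  - apply circle_integral_on.
  - apply circle_double_pole_free.
  - intros s Hs; apply circle_off.
    replace (p + s * (w - p) - p) with (s * (w - p)) by ring.
    rewrite Cmod_mult, Cmod_R, Rabs_pos_eq by lra; nra.
Qed.

Lemma slope_differentiable_off (f : C -> C) (w z : C) :
  differentiable_at f z -> z <> w -> differentiable_at (slope f w) z.
Proof.
  intros Hf Hz; assert (Hn : z - w <> 0) by (apply Cminus_eq_contra; exact Hz).
  apply differentiable_ext_loc with (fun v => (f v - f w) / (v - w)).
  - generalize (continuous_neq0 (fun v => v - w) z ltac:(auto with ccont) Hn).
    apply filter_imp; intros v Hv; symmetry; apply slope_neq.
    intros ->; apply Hv; ring.
  - apply differentiable_div; [| |exact Hn].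
    + apply differentiable_minus; [exact Hf|apply differentiable_const].
    + apply differentiable_minus; [apply differentiable_id|apply differentiable_const].
Qed.

(* The contraction z |-> w + s (z - w) sweeps the circle towards w.  By Goursat
   the integral over the contracted circle does not depend on s > 0, and it is
   O(s) as F is continuous at w. *)
Lemma circle_contraction (p : C) (r : R) (w : C) (F : C -> C) :
  (Cmod (w - p) < r)%R ->
  (forall z, (Cmod (z - p) <= r)%R -> z <> w -> differentiable_at F z) ->
  continuous (T := C_UniformSpace) (U := C_UniformSpace) F w ->
  circle_integral p r F = 0.
Proof.
  intros Hw HF Hc; assert (Hwp := Cmod_ge_0 (w - p)).
  assert (Hr : (0 < r)%R) by lra.
  set (H := fun (s t : R) => w + s * (circle p r t - w)).
  set (Hs := fun (s t : R) => circle p r t - w).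
  set (Ht := fun (s t : R) => s * dcircle r t).
  assert (HM : forall t, (Cmod (circle p r t - w) <= 2 * r)%R).
  { intros t; assert (T := Cmod_triangle_minus (circle p r t) p w).
    rewrite Cmod_circle, (Cmod_minus_sym p) in T; lra. }
  assert (Hn : forall t, (0 < Cmod (circle p r t - w))%R).
  { intros t; assert (T := Cmod_triangle_minus (circle p r t) w p).
    rewrite Cmod_circle in T; lra. }
  assert (HL : forall t t', (Cmod (circle p r t - circle p r t') <= r * Rabs (t - t'))%R).
  { intros t t'; apply (arc_lipschitz (circle p r) (dcircle r) (Rmin t t') (Rmax t t')).
    - apply circle_C1.
    - intros u _; rewrite Cmod_dcircle; lra.
    - split; [apply Rmin_l|apply Rmax_l].
    - split; [apply Rmin_r|apply Rmax_r]. }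
  assert (CHs : forall t a b, C1_arc (fun s => H s t) (fun s => Hs s t) a b).
  { intros t a b s _; split; [apply is_derive_segment|apply continuous_Cconst]. }
  assert (CHt : forall s a b, C1_arc (H s) (Ht s) a b).
  { intros s a b t Ht'; destruct (circle_C1 p r a b t Ht') as [D1 D2]; split.
    - apply (is_derive_comp_C (fun v => w + s * (v - w)) (circle p r)); [|exact D1].
      apply (factors_at_is_derive (fun v => w + s * (v - w)) (fun _ => RtoC s)).
      apply factors_at_global; [apply continuous_Cconst|intros v; ring].
    - apply continuous_Cmult; [apply continuous_Cconst|exact D2]. }
  (* The disc is convex, so the contracted circle stays in it, and s > 0 keeps it away from w. *)
  assert (Hdiff : forall s t, (0 < s <= 1)%R -> differentiable_at F (H s t)).
  { intros s t Hsi; apply HF.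
    - replace (H s t - p) with ((1 - s)%R * (w - p) + s * (circle p r t - p))
        by (unfold H; rewrite RtoC_minus; ring).
      eapply Rle_trans; [apply Cmod_triangle|].
      rewrite !Cmod_mult, !Cmod_R, Cmod_circle, !Rabs_pos_eq by lra; nra.
    - intros E; assert (E' : s * (circle p r t - w) = 0).
      { transitivity (H s t - w); [unfold H; ring|rewrite E; ring]. }
      apply (f_equal Cmod) in E'.
      rewrite Cmod_mult, Cmod_R, Rabs_pos_eq, Cmod_0 in E' by lra.
      specialize (Hn t); nra. }
  assert (Hinv : forall sig, (0 < sig < 1)%R ->
            circle_integral p r F = arc_integral (H sig) (Ht sig) 0 (2 * PI) F).
  { intros sig Hsig.
    assert (G := goursat H Hs Ht (Rectangle sig 1 0 (2 * PI)) (2 * r) F).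
    simpl in G; unfold on_rectangle, boundary_integral in G; simpl in G.
    (* The sides t = 0 and t = 2 PI of the parameter rectangle are the same segment traversed in
       opposite directions; only the two circles remain. *)
    assert (E1 : arc_integral (fun s => H s 0%R) (fun s => Hs s 0%R) sig 1 F
               = arc_integral (fun s => H s (2 * PI)%R) (fun s => Hs s (2 * PI)%R) sig 1 F).
    { apply CRInt_ext; intros s _; unfold H, Hs; rewrite circle_closed; reflexivity. }
    assert (E2 : arc_integral (H 1%R) (Ht 1%R) 0 (2 * PI) F = circle_integral p r F).
    { apply CRInt_ext; intros t _; unfold H, Ht.
      replace (w + 1%R * (circle p r t - w)) with (circle p r t) by ring; ring. }
    rewrite E1, E2 in G.
    set (I1 := arc_integral _ _ sig 1 F) in G.
    assert (G0 : I1 + circle_integral p r F - I1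
                 - arc_integral (H sig) (Ht sig) 0 (2 * PI) F = 0).
    { apply G; auto.
      - unfold sub_rectangle; simpl; generalize two_PI_pos; lra.
      - intros s t [Hsi _]; split; [apply HM|].
        unfold Ht; rewrite Cmod_mult, Cmod_R, Cmod_dcircle, Rabs_pos_eq by lra; nra.
      - intros s t s' t' [Hsi _] [Hsi' _].
        replace (H s t - H s' t')
          with ((s - s')%R * (circle p r t - w) + s' * (circle p r t - circle p r t'))
          by (unfold H; rewrite RtoC_minus; ring).
        eapply Rle_trans; [apply Cmod_triangle|].
        rewrite !Cmod_mult, !Cmod_R, (Rabs_pos_eq s') by lra.
        specialize (HM t); specialize (HL t t').
        assert (P1 := Rabs_pos (s - s')); assert (P2 := Rabs_pos (t - t')).
        assert (P3 := Cmod_ge_0 (circle p r t - circle p r t')).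
        assert (Q1 : (Rabs (s - s') * Cmod (circle p r t - w) <= Rabs (s - s') * (2 * r))%R)
          by (apply Rmult_le_compat_l; assumption).
        nra.
      - intros s t [Hsi _]; apply Hdiff; lra. }
    replace (circle_integral p r F)
      with (I1 + circle_integral p r F - I1 - arc_integral (H sig) (Ht sig) 0 (2 * PI) F
            + arc_integral (H sig) (Ht sig) 0 (2 * PI) F) by ring.
    rewrite G0; ring. }
  rewrite continuous_C_at in Hc; destruct (Hc 1%R Rlt_0_1) as (d & Hd & Hnear).
  set (B := (Cmod (F w) + 1)%R).
  assert (HB0 : (0 < B)%R) by (unfold B; generalize (Cmod_ge_0 (F w)); lra).
  apply Cmod_eq_0, Rle_antisym; [|apply Cmod_ge_0].
  set (X := Cmod (circle_integral p r F)).
  destruct (Rle_lt_dec X 0) as [H0|H0]; [exact H0|exfalso].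
  set (D := (2 * PI * (B * r))%R).
  assert (HD : (0 < D)%R) 
    by (unfold D; apply Rmult_lt_0_compat;
        [generalize PI_RGT_0; lra|apply Rmult_lt_0_compat; assumption]).
  (* The first bound keeps [sig] below 1. The second puts the contracted circle within d of w, as |z
     - w| <= 2r on the circle, whence |F| <= B there. The third turns the estimate X <= D sig into X
     <= X / 2. *)
  set (sig := Rmin (1 / 2) (Rmin (d / (4 * r)) (X / (2 * D)))).
  assert (Hsig0 : (0 < sig)%R).
  { unfold sig; repeat apply Rmin_pos; try apply Rdiv_lt_0_compat; lra. }
  assert (Hsig1 : (sig <= 1 / 2)%R) by apply Rmin_l.
  assert (Hsig2 : (sig <= d / (4 * r))%R) by (eapply Rle_trans; [apply Rmin_r|apply Rmin_l]).
  assert (Hsig3 : (sig <= X / (2 * D))%R) by (eapply Rle_trans; [apply Rmin_r|apply Rmin_r]).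
  assert (HX : (X <= (2 * PI - 0) * (B * (sig * r)))%R).
  { unfold X; rewrite (Hinv sig) by lra.
    apply arc_integral_bound; auto using two_PI_pos.
    - intros z [t [_ <-]]; apply differentiable_continuous, Hdiff; lra.
    - intros t _; unfold Ht; rewrite Cmod_mult, Cmod_R, Cmod_dcircle, Rabs_pos_eq; lra.
    - intros t _.
      assert (HH : (Cmod (H sig t - w) < d)%R).
      { replace (H sig t - w) with (sig * (circle p r t - w)) by (unfold H; ring).
        rewrite Cmod_mult, Cmod_R, Rabs_pos_eq by lra.
        apply Rle_lt_trans with (d / (4 * r) * (2 * r))%R.
        - apply Rmult_le_compat; [lra|apply Cmod_ge_0|exact Hsig2|apply HM].
        - replace (d / (4 * r) * (2 * r))%R with (d / 2)%R by (field; lra); lra. }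
      apply Hnear in HH.
      assert (T := Cmod_triangle (F (H sig t) - F w) (F w)).
      replace (F (H sig t) - F w + F w) with (F (H sig t)) in T by ring.
      unfold B; lra. }
  replace ((2 * PI - 0) * (B * (sig * r)))%R with (D * sig)%R in HX by (unfold D; ring).
  assert (HX2 : (D * sig <= D * (X / (2 * D)))%R) by (apply Rmult_le_compat_l; lra).
  replace (D * (X / (2 * D)))%R with (X / 2)%R in HX2 by (field; lra).
  lra.
Qed.

Lemma C2PIi_neq0 : 2 * PI * Ci <> 0.
Proof.
  apply Cmult_neq_0; [apply Cmult_neq_0|].
  - intros E; apply RtoC_inj in E; lra.
  - intros E; apply RtoC_inj in E; generalize PI_RGT_0; lra.
  - intros E; apply (f_equal snd) in E; simpl in E; lra.
Qed.

(** At this stage [slope f w] is known to be continuous at w and differentiable elsewhere, which is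
    what [circle_contraction] asks for. Its vanishing integral reduces the claim to the index of the
    circle. *)
Lemma cauchy_circle (p : C) (r : R) (w : C) (f : C -> C) :
  (Cmod (w - p) < r)%R ->
  (forall z, (Cmod (z - p) <= r)%R -> differentiable_at f z) ->
  circle_integral p r (fun z => f z / (z - w)) = 2 * PI * Ci * f w.
Proof.
  intros Hw Hf; assert (Hwp := Cmod_ge_0 (w - p)).
  assert (Hoff := circle_off p r w Hw).
  assert (Hcf : continuous_along (circle_trace p r) f).
  { intros z Hz; apply differentiable_continuous, Hf.
    apply circle_trace_dist in Hz; lra. }
  assert (Hc1 : continuous_along (circle_trace p r) (fun z => f z / (z - w))).
  { intros z Hz; assert (Cz := Hcf z Hz); eauto with ccont. }
  assert (Hc2 : continuous_along (circle_trace p r) (fun z => 1 / (z - w))).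
  { intros z Hz; eauto with ccont. }
  assert (H0 : circle_integral p r (slope f w) = 0).
  { apply (circle_contraction p r w); auto.
    - intros z Hz Hzw; apply slope_differentiable_off; auto.
    - apply slope_factors, Hf; lra. }
  assert (H1 : circle_integral p r (slope f w)
               = circle_integral p r (fun z => f z / (z - w) + - f w * (1 / (z - w)))).
  { apply (int_ext _ _ _ _ (circle_integral_on p r)).
    - intros z Hz; apply differentiable_continuous, slope_differentiable_off.
      + apply Hf; apply circle_trace_dist in Hz; lra.
      + intros ->; auto.
    - intros z Hz; apply continuous_Cplus; [apply Hc1, Hz|].
      apply continuous_Cmult; [apply continuous_Cconst|apply Hc2, Hz].
    - intros z Hz; rewrite slope_neq by (intros ->; auto).
      field; eapply off_neq; eassumption. }
  rewrite (int_lin _ _ (circle_integral_on p r)), circle_index in H1 by assumption.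
  set (I := circle_integral p r (fun z => f z / (z - w))) in *.
  transitivity (I + - f w * (2 * PI * Ci) + f w * (2 * PI * Ci)); [ring|].
  rewrite <- H1, H0; ring.
Qed.

(** * Difference quotients and Liouville's theorem *)

Lemma open_disc (Omega : C -> Prop) (w : C) :
  open (T := C_UniformSpace) Omega -> Omega w ->
  exists r : R, (0 < r)%R /\ forall z, (Cmod (z - w) <= r)%R -> Omega z.
Proof.
  intros HO Hw; apply HO in Hw; apply locally_Cmod in Hw; destruct Hw as [d [Hd H]].
  exists (d / 2)%R; split; [lra|intros z Hz; apply H; lra].
Qed.

(** Cauchy's formula at u and at w, subtracted by the resolvent identity, shows that the right-hand
    side is a Caratheodory factor of f at w. Uniqueness of the factor includes z = w, which is
    Cauchy's formula for the derivative. *)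
Lemma slope_circle (p : C) (r : R) (f : C -> C) (w z : C) :
  (Cmod (w - p) < r)%R -> (Cmod (z - p) < r)%R ->
  (forall z, (Cmod (z - p) <= r)%R -> differentiable_at f z) ->
  slope f w z = / (2 * PI * Ci) * circle_integral p r (fun v => f v / (v - w) / (v - z)).
Proof.
  intros Hw Hz Hf; assert (Hwp := Cmod_ge_0 (w - p)).
  assert (Hcf : continuous_along (circle_trace p r) f).
  { intros v Hv; apply differentiable_continuous, Hf.
    apply circle_trace_dist in Hv; lra. }
  assert (E : forall u, (Cmod (u - p) < r)%R ->
    f u = f w + (u - w) * (/ (2 * PI * Ci)
             * circle_integral p r (fun v => f v / (v - w) / (v - u)))).
  { intros u Hu.
    transitivity (f w + / (2 * PI * Ci)
       * ((u - w) * circle_integral p r (fun v => f v / (v - w) / (v - u)))); [|ring].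
    rewrite <- (kernel_slope _ _ f w u (circle_integral_on p r))
      by auto using circle_off.
    rewrite !cauchy_circle by assumption.
    generalize C2PIi_neq0; generalize (2 * PI * Ci); intros c Hc; field; exact Hc. }
  apply (factors_at_slope f (fun u => / (2 * PI * Ci)
             * circle_integral p r (fun v => f v / (v - w) / (v - u))));
    [split|apply E, Hz].
  - apply continuous_Cmult; [apply continuous_Cconst|].
    apply (kernel_continuous _ _ (fun v => f v / (v - w)) w (circle_integral_on p r)).
    + intros v Hv; assert (Cv := Hcf v Hv).
      assert (v - w <> 0) by (eapply off_neq; [apply circle_off, Hw|exact Hv]).
      auto with ccont.
    + apply circle_off, Hw.
  - apply locally_Cmod; exists (r - Cmod (w - p))%R; split; [lra|].
    intros u Hu; apply E.
    assert (T := Cmod_triangle_minus u w p); lra.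
Qed.

(* Riemann's removable singularity theorem for the difference quotient. *)
Lemma slope_analytic (Omega : C -> Prop) (f : C -> C) (w : C) :
  open (T := C_UniformSpace) Omega -> analytic_on Omega f -> Omega w ->
  analytic_on Omega (slope f w).
Proof.
  intros HO Hf Hw z Hz; destruct (Ceq_dec z w) as [->|Hn].
  2: apply slope_differentiable_off; [apply Hf, Hz|exact Hn].
  destruct (open_disc _ _ HO Hw) as (r & Hr & Hdisc).
  assert (Hww : (Cmod (w - w) < r)%R)
    by (replace (w - w) with (RtoC 0) by ring; rewrite Cmod_0; exact Hr).
  assert (Hoff := circle_off w r w Hww).
  apply (differentiable_ext_loc (fun z => / (2 * PI * Ci)
     * circle_integral w r (fun v => f v / (v - w) / (v - z)))).
  - apply locally_Cmod; exists r; split; [exact Hr|].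
    intros u Hu; symmetry; apply slope_circle; auto.
    intros v Hv; apply Hf, Hdisc, Hv.
  - apply differentiable_mult; [apply differentiable_const|].
    apply (kernel_differentiable _ _ (fun v => f v / (v - w)) w (circle_integral_on w r));
      [|exact Hoff].
    intros v Hv; assert (v - w <> 0) by (eapply off_neq; eassumption).
    assert (continuous (T := C_UniformSpace) (U := C_UniformSpace) f v).
    { apply differentiable_continuous, Hf, Hdisc.
      apply circle_trace_dist in Hv; lra. }
    auto with ccont.
Qed.

(** Expanding f at w0 and Q = [slope f w0] at w gives f u = f w + (u - w)(Q w + (u - w0)
    [slope Q w u]). Uniqueness of the factor at w turns this into the identity, also for z = w. *)
Lemma slope_shift (f : C -> C) (w0 w z : C) :
  differentiable_at f w -> differentiable_at (slope f w0) w ->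
  slope f w z - slope f w0 z = (w - w0) * slope (slope f w0) w z.
Proof.
  intros Hf HQ; set (Q := slope f w0) in *.
  assert (E : forall u, f u = f w + (u - w) * (Q w + (u - w0) * slope Q w u)).
  { intros u; rewrite (slope_eq f w0 u), (slope_eq f w0 w); fold Q.
    transitivity (f w0 + (u - w0) * Q w + (u - w0) * (u - w) * slope Q w u); [|ring].
    rewrite (slope_eq Q w u) at 1; ring. }
  rewrite (factors_at_slope f (fun u => Q w + (u - w0) * slope Q w u) w z); auto.
  - rewrite (slope_eq Q w z); ring.
  - apply factors_at_global; [|exact E].
    apply slope_factors in HQ; destruct HQ as [HQ _]; auto with ccont.
Qed.

(** K may pass through w0, where the quotient itself gives no bound. For z within r/2 of w0 the
    slope is estimated by its integral over the circle of radius r; for the other z the denominator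
    is at least r/4. *)
Lemma slope_locally_bounded (Omega K : C -> Prop) (L : (C -> C) -> C) (f : C -> C) (w0 : C) :
  open (T := C_UniformSpace) Omega -> analytic_on Omega f -> Omega w0 ->
  integral_on K L -> (forall z, K z -> Omega z) ->
  exists B d : R, (0 <= B)%R /\ (0 < d)%R /\
    forall w z, (Cmod (w - w0) < d)%R -> K z -> (Cmod (slope f w z) <= B)%R.
Proof.
  intros HO Hf Hw0 HL HK.
  destruct (open_disc _ _ HO Hw0) as (r & Hr & Hdisc).
  assert (Hc : forall K', (forall z, K' z -> Omega z) -> continuous_along K' f).
  { intros K' HK' z Hz; apply differentiable_continuous, Hf, HK', Hz. }
  destruct (int_compact _ _ HL f (Hc K HK)) as (B1 & HB1 & HfB1).
  assert (Hcirc : continuous_along (circle_trace w0 r) f).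
  { apply Hc; intros z Hz; apply Hdisc; apply circle_trace_dist in Hz; lra. }
  destruct (int_compact _ _ (circle_integral_on w0 r) f Hcirc) as (B2 & HB2 & HfB2).
  assert (Hcw := differentiable_continuous _ _ (Hf w0 Hw0)).
  rewrite continuous_C_at in Hcw; destruct (Hcw 1%R Rlt_0_1) as (d1 & Hd1 & Hnear).
  (* In [B3] both denominators on the circle are at least r/2. In [B4] one has |f z| <= B1 on K and
     |f w| <= |f w0| + 1 near w0. *)
  set (B3 := (Cmod (/ (2 * PI * Ci)) * (2 * PI * (B2 / (r / 2) / (r / 2) * r)))%R).
  set (B4 := ((B1 + (Cmod (f w0) + 1)) / (r / 4))%R).
  assert (HB3 : (0 <= B3)%R).
  { apply Rmult_le_pos; [apply Cmod_ge_0|].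
    apply Rmult_le_pos; [apply two_PI_pos|].
    apply Rmult_le_pos; [|lra]; repeat apply Rdiv_le_0_compat; lra. }
  assert (HB4 : (0 <= B4)%R).
  { apply Rdiv_le_0_compat; [|lra]; generalize (Cmod_ge_0 (f w0)); lra. }
  exists (B3 + B4)%R, (Rmin d1 (r / 4)); split; [lra|split; [apply Rmin_pos; lra|]].
  intros w z Hw Hz.
  assert (Hwd := Rlt_le_trans _ _ _ Hw (Rmin_l _ _)).
  assert (Hwr := Rlt_le_trans _ _ _ Hw (Rmin_r _ _)).
  destruct (Rlt_le_dec (Cmod (z - w0)) (r / 2)) as [Hzr|Hzr].
  - apply Rle_trans with B3; [|lra].
    rewrite (slope_circle w0 r) by (try lra; intros v Hv; apply Hf, Hdisc, Hv).
    assert (Hfar : forall v u, circle_trace w0 r v -> (Cmod (u - w0) < r / 2)%R ->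
              (r / 2 <= Cmod (v - u))%R /\ v - u <> 0).
    { intros v u Hv Hu.
      assert (r / 2 <= Cmod (v - u))%R.
      { apply circle_trace_dist in Hv; [|lra].
        assert (T := Cmod_triangle_minus v u w0); lra. }
      split; [assumption|apply Cmod_gt_0; lra]. }
    rewrite Cmod_mult; apply Rmult_le_compat_l; [apply Cmod_ge_0|].
    apply circle_integral_bound; [lra| |].
    + intros v Hv; assert (Cv := Hcirc v Hv).
      destruct (Hfar v w Hv) as [_ N1]; [lra|]; destruct (Hfar v z Hv Hzr) as [_ N2].
      auto with ccont.
    + intros v Hv.
      destruct (Hfar v w Hv) as [M1 N1]; [lra|]; destruct (Hfar v z Hv Hzr) as [M2 N2].
      rewrite !Cmod_div by assumption.
      apply Rmult_le_compat.
      * apply Rdiv_le_0_compat; [apply Cmod_ge_0|lra].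
      * left; apply Rinv_0_lt_compat; lra.
      * apply Rmult_le_compat; [apply Cmod_ge_0| |apply HfB2, Hv|].
        -- left; apply Rinv_0_lt_compat; lra.
        -- apply Rinv_le_contravar; lra.
      * apply Rinv_le_contravar; lra.
  - apply Rle_trans with B4; [|lra].
    assert (Hzw : (r / 4 <= Cmod (z - w))%R).
    { assert (T := Cmod_triangle_minus z w w0); lra. }
    assert (N : z - w <> 0) by (apply Cmod_gt_0; lra).
    rewrite slope_neq by (intros ->; apply N; ring).
    rewrite Cmod_div by exact N.
    apply Rmult_le_compat; [apply Cmod_ge_0| | |apply Rinv_le_contravar; lra].
    + left; apply Rinv_0_lt_compat; lra.
    + unfold Cminus; eapply Rle_trans; [apply Cmod_triangle|].
      rewrite Cmod_opp; apply Rplus_le_compat; [apply HfB1, Hz|].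
      specialize (Hnear w Hwd).
      assert (T := Cmod_triangle (f w - f w0) (f w0)).
      replace (f w - f w0 + f w0) with (f w) in T by ring; lra.
Qed.

(** Cauchy's formula at the centre bounds |G w| by any bound for |G| on a circle around w, and on
    large circles G is small. *)
Lemma entire_vanishing_at_infinity (G : C -> C) :
  (forall z, differentiable_at G z) ->
  (forall eps : R, (0 < eps)%R -> exists A : R,
     forall z, (A < Cmod z)%R -> (Cmod (G z) <= eps)%R) ->
  forall w, G w = 0.
Proof.
  intros HG Hinf w; apply Cmod_eq_0, Rle_antisym; [|apply Cmod_ge_0].
  apply Rle_plus_epsilon; intros eps Heps; rewrite Rplus_0_l.
  destruct (Hinf eps Heps) as [A HA].
  (* Points at distance r from w have modulus at least r - |w| = |A| + 1 > A. *)
  set (r := (Cmod w + Rabs A + 1)%R).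
  assert (Hw0 := Cmod_ge_0 w); assert (HA0 := Rle_abs A); assert (HA1 := Rabs_pos A).
  assert (Hr : (0 < r)%R) by (unfold r; lra).
  assert (Hww : (Cmod (w - w) < r)%R)
    by (replace (w - w) with (RtoC 0) by ring; rewrite Cmod_0; exact Hr).
  assert (E := cauchy_circle w r w G Hww (fun z _ => HG z)).
  assert (HB : (Cmod (circle_integral w r (fun z => G z / (z - w))%C)
                <= 2 * PI * (eps / r * r))%R).
  { apply circle_integral_bound; [lra| |].
    - intros z Hz; assert (Cz := differentiable_continuous _ _ (HG z)).
      assert (z - w <> 0) by (eapply off_neq; [apply circle_off, Hww|exact Hz]).
      auto with ccont.
    - intros z Hz; apply circle_trace_dist in Hz; [|lra].
      assert (N : z - w <> 0) by (apply Cmod_gt_0; lra).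
      rewrite Cmod_div, Hz by exact N.
      apply Rmult_le_compat_r; [left; apply Rinv_0_lt_compat; exact Hr|].
      apply HA.
      assert (T := Cmod_triangle z (- w)); rewrite Cmod_opp in T.
      change (z + - w) with (z - w) in T; unfold r in Hz; lra. }
  rewrite E, !Cmod_mult, Cmod_Ci, !Cmod_R, !Rabs_pos_eq in HB
    by (generalize PI_RGT_0; lra).
  replace (eps / r * r)%R with eps in HB by (field; lra).
  apply Rmult_le_reg_l with (2 * PI)%R; [generalize PI_RGT_0; lra|lra].
Qed.

(** * The homology form of Cauchy's theorem *)

Lemma kernel_vanishes_at_infinity (K : C -> Prop) (L : (C -> C) -> C) (F : C -> C) :
  integral_on K L -> continuous_along K F ->
  forall eps : R, (0 < eps)%R -> exists A : R, forall w, (A < Cmod w)%R ->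
    ~ K w /\ (Cmod (L (fun z => F z / (z - w))%C) <= eps)%R.
Proof.
  intros HL HF eps Heps.
  destruct (int_bound _ _ HL) as (M & HM0 & HM).
  destruct (int_compact _ _ HL F HF) as (B & HB0 & HB).
  (* Applied to the identity function, compactness says that K is bounded. *)
  destruct (int_compact _ _ HL (fun z => z)) as (A & HA0 & HA).
  { intros z _; apply continuous_Cid. }
  set (D := (M * B / eps + 1)%R).
  assert (HMB : (0 <= M * B / eps)%R) by (apply Rdiv_le_0_compat; nra).
  exists (A + D)%R; intros w Hw.
  assert (Hfar : forall z, K z -> (D <= Cmod (z - w))%R).
  { intros z Hz; specialize (HA z Hz).
    assert (T := Cmod_triangle_minus w z 0); rewrite (Cmod_minus_sym w z) in T.
    replace (w - 0) with w in T by ring; replace (z - 0) with z in T by ring; lra. }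
  assert (Hw' : ~ K w) by (intros H; specialize (HA w H); unfold D in Hw; lra).
  split; [exact Hw'|].
  apply Rle_trans with (M * (B / D))%R.
  - apply HM; [apply Rdiv_le_0_compat; unfold D; lra| |].
    + intros z Hz; assert (Cz := HF z Hz); eauto with ccont.
    + intros z Hz; rewrite Cmod_div by (eapply off_neq; eassumption).
      apply Rmult_le_compat; [apply Cmod_ge_0| |apply HB, Hz|].
      * left; apply Rinv_0_lt_compat; specialize (Hfar z Hz); unfold D in *; lra.
      * apply Rinv_le_contravar; [unfold D; lra|apply Hfar, Hz].
  - apply Rmult_le_reg_r with D; [unfold D; lra|].
    replace (M * (B / D) * D)%R with (M * B)%R by (field; unfold D; lra).
    replace (eps * D)%R with (M * B + eps)%R by (unfold D; field; lra); lra.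
Qed.

(** The index tends to 0 along every ray and is constant on the part of the ray beyond K, so it is
    exactly 0 there. Dixon's argument needs this exact value, as it compares two formulas near
    infinity. *)
Lemma index_zero_at_infinity (K : C -> Prop) (L : (C -> C) -> C) :
  integral_on K L -> double_pole_free K L ->
  exists A : R, forall w, (A < Cmod w)%R -> L (fun z => 1 / (z - w)) = 0.
Proof.
  intros HL HD.
  assert (Hc : continuous_along K (fun _ => 1)) by (intros z _; apply continuous_Cconst).
  assert (Hinf := kernel_vanishes_at_infinity K L (fun _ => 1) HL Hc).
  destruct (Hinf 1%R Rlt_0_1) as [A HA].
  exists (Rmax A 0); intros w Hw.
  assert (Hw1 := Rle_lt_trans _ _ _ (Rmax_l _ _) Hw).
  assert (Hw2 := Rle_lt_trans _ _ _ (Rmax_r _ _) Hw).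
  apply Cmod_eq_0, Rle_antisym; [|apply Cmod_ge_0].
  apply Rle_plus_epsilon; intros eps Heps; rewrite Rplus_0_l.
  destruct (Hinf eps Heps) as [A' HA'].
  (* Stretching w by S gives modulus |A'| + |w|, beyond A', and the segment from w to S w never
     comes closer to 0 than w. *)
  set (S := (Rabs A' / Cmod w + 1)%R).
  assert (HS : (0 <= Rabs A' / Cmod w)%R) by (apply Rdiv_le_0_compat; [apply Rabs_pos|lra]).
  rewrite (index_constant_on_segment K L w (S * w) HL HD).
  - apply HA'; rewrite Cmod_mult, Cmod_R, Rabs_pos_eq by (unfold S; lra).
    replace (S * Cmod w)%R with (Rabs A' + Cmod w)%R by (unfold S; field; lra).
    generalize (Rle_abs A'); lra.
  - intros s Hs; apply HA.
    replace (w + s * (S * w - w)) with (RtoC (1 + s * (S - 1))%R * w)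
      by (rewrite RtoC_plus, RtoC_mult, RtoC_minus; ring).
    assert (Hq : (1 <= 1 + s * (S - 1))%R) by (unfold S; nra).
    rewrite Cmod_mult, Cmod_R, Rabs_pos_eq by lra; nra.
Qed.

Lemma slope_continuous_along (Omega K : C -> Prop) (f : C -> C) (w : C) :
  open (T := C_UniformSpace) Omega -> analytic_on Omega f -> (forall z, K z -> Omega z) ->
  Omega w -> continuous_along K (slope f w).
Proof.
  intros HO Hf HK Hw z Hz; apply differentiable_continuous.
  apply (slope_analytic Omega); auto.
Qed.

Lemma slope_integral_shift (Omega K : C -> Prop) (L : (C -> C) -> C) (f : C -> C) (w0 w : C) :
  open (T := C_UniformSpace) Omega -> analytic_on Omega f ->
  integral_on K L -> (forall z, K z -> Omega z) -> Omega w0 -> Omega w ->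
  L (slope f w) - L (slope f w0) = (w - w0) * L (slope (slope f w0) w).
Proof.
  intros HO Hf HL HK Hw0 Hw.
  assert (HQ : analytic_on Omega (slope f w0)) by (apply slope_analytic; auto).
  assert (C1 : forall g u, analytic_on Omega g -> Omega u -> continuous_along K (slope g u))
    by (intros; apply (slope_continuous_along Omega); assumption).
  rewrite (int_minus _ _ _ _ HL), <- (int_scal _ _ _ _ HL) by auto.
  apply (int_ext K); auto.
  - intros z Hz; apply continuous_Cplus; [|apply continuous_Cmult]; auto with ccont;
      apply C1; auto.
  - intros z Hz; apply continuous_Cmult; [apply continuous_Cconst|apply C1; auto].
  - intros z Hz; rewrite <- slope_shift by (try apply Hf; try apply HQ; assumption); ring.
Qed.

(** By the integrated shift identity, w |-> L ([slope Q w]) is a Caratheodory factor at w0. Its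
    continuity there is the same identity for Q, combined with the local bound on
    [slope (slope Q w0) w]. *)
Lemma slope_integral_differentiable (Omega K : C -> Prop) (L : (C -> C) -> C)
    (f : C -> C) (w0 : C) :
  open (T := C_UniformSpace) Omega -> analytic_on Omega f ->
  integral_on K L -> (forall z, K z -> Omega z) -> Omega w0 ->
  differentiable_at (fun w => L (slope f w)) w0.
Proof.
  intros HO Hf HL HK Hw0.
  set (Q := slope f w0).
  assert (HQ : analytic_on Omega Q) by (apply slope_analytic; auto).
  assert (HQ2 : analytic_on Omega (slope Q w0)) by (apply slope_analytic; auto).
  apply (factors_at_differentiable _ (fun w => L (slope Q w))); split.
  - apply continuous_C_at; intros eps Heps.
    destruct (open_disc _ _ HO Hw0) as (r & Hr & Hdisc).
    destruct (int_bound _ _ HL) as (M & HM0 & HM).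
    destruct (slope_locally_bounded Omega K L (slope Q w0) w0)
      as (B & d & HB0 & Hd & HB); auto.
    assert (HMB : (0 <= M * B)%R) by nra.
    exists (Rmin (Rmin r d) (eps / (M * B + 1))); split.
    { repeat apply Rmin_pos; auto; apply Rdiv_lt_0_compat; lra. }
    intros w Hw.
    assert (Hw1 := Rlt_le_trans _ _ _ Hw (Rmin_l _ _)).
    assert (Hw2 := Rlt_le_trans _ _ _ Hw (Rmin_r _ _)).
    assert (Hwr := Rlt_le_trans _ _ _ Hw1 (Rmin_l _ _)).
    assert (Hwd := Rlt_le_trans _ _ _ Hw1 (Rmin_r _ _)).
    assert (Hww : Omega w) by (apply Hdisc; lra).
    rewrite (slope_integral_shift Omega K) by auto.
    rewrite Cmod_mult.
    apply Rle_lt_trans with (Cmod (w - w0) * (M * B + 1))%R.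
    + apply Rmult_le_compat_l; [apply Cmod_ge_0|].
      apply Rle_trans with (M * B)%R; [|lra].
      apply HM; auto.
      apply (slope_continuous_along Omega); auto.
    + replace eps with (eps / (M * B + 1) * (M * B + 1))%R by (field; lra).
      apply Rmult_lt_compat_r; lra.
  - destruct (open_disc _ _ HO Hw0) as (r & Hr & Hdisc).
    apply locally_Cmod; exists r; split; [exact Hr|intros w Hw].
    unfold Q; rewrite <- (slope_integral_shift Omega K) by (auto; apply Hdisc; lra).
    C_eq; ring.
Qed.

(* Dixon's argument: w |-> L (slope f w) extends, by the Cauchy transform of f,
   to an entire function which tends to 0 at infinity. *)
Lemma dixon (Omega K : C -> Prop) (L : (C -> C) -> C) (f : C -> C) :
  open (T := C_UniformSpace) Omega -> analytic_on Omega f ->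
  integral_on K L -> double_pole_free K L -> (forall z, K z -> Omega z) ->
  (forall w, ~ Omega w -> L (fun z => 1 / (z - w)) = 0) ->
  forall w, Omega w -> L (slope f w) = 0.
Proof.
  intros HO Hf HL HD HK H0.
  set (T := fun w => L (fun z => f z / (z - w))).
  set (G := fun w => if excluded_middle_informative (Omega w) then L (slope f w) else T w).
  assert (HGin : forall w, Omega w -> G w = L (slope f w)).
  { intros w Hw; unfold G; destruct (excluded_middle_informative (Omega w)); tauto. }
  assert (HGout : forall w, ~ Omega w -> G w = T w).
  { intros w Hw; unfold G; destruct (excluded_middle_informative (Omega w)); tauto. }
  assert (Hcf : continuous_along K f)
    by (intros z Hz; apply differentiable_continuous, Hf, HK, Hz).
  (* On Omega the two formulas differ by f w times the index of w, so they agree wherever the index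
     vanishes. *)
  assert (HGT : forall w, ~ K w -> L (fun z => 1 / (z - w)) = 0 -> G w = T w).
  { intros w Hw Hi; destruct (classic (Omega w)) as [Hin|Hout]; [|apply HGout, Hout].
    rewrite HGin by exact Hin.
    assert (C1 : continuous_along K (fun z => f z / (z - w))).
    { intros z Hz; assert (Cz := Hcf z Hz); eauto with ccont. }
    assert (C2 : continuous_along K (fun z => 1 / (z - w))).
    { intros z Hz; eauto with ccont. }
    transitivity (L (fun z => f z / (z - w) + - f w * (1 / (z - w)))).
    - apply (int_ext K); auto.
      + apply (slope_continuous_along Omega); auto.
      + intros z Hz; apply continuous_Cplus; [apply C1, Hz|].
        apply continuous_Cmult; [apply continuous_Cconst|apply C2, Hz].
      + intros z Hz; rewrite slope_neq by (intros ->; auto).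
        field; eapply off_neq; eassumption.
    - rewrite (int_lin _ _ HL), Hi by assumption; unfold T; ring. }
  assert (HG : forall w, G w = 0).
  { apply entire_vanishing_at_infinity.
    - intros w0; destruct (classic (Omega w0)) as [Hin|Hout].
      + apply (differentiable_ext_loc (fun w => L (slope f w))).
        * destruct (open_disc _ _ HO Hin) as (r & Hr & Hdisc).
          apply locally_Cmod; exists r; split; [exact Hr|].
          intros w Hw; symmetry; apply HGin, Hdisc; lra.
        * apply (slope_integral_differentiable Omega K); auto.
      (* A disc around w0 may meet Omega, so both cases of [G] can occur in it. The index is 0 at w0
         and constant on a disc off K, hence G coincides with T throughout that disc. *)
      + assert (HK0 : ~ K w0) by (intros HK0; auto).
        apply (differentiable_ext_loc T).
        * destruct (int_far _ _ _ HL HK0) as (d & Hd & Hfar).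
          assert (Hseg : forall w, (Cmod (w - w0) < d)%R -> ~ K w).
          { intros w Hw HKw; specialize (Hfar w HKw); lra. }
          apply locally_Cmod; exists d; split; [exact Hd|].
          intros w Hw; symmetry; apply HGT; [apply Hseg, Hw|].
          rewrite <- (index_constant_on_segment K L w0 w HL HD); [apply H0, Hout|].
          intros s Hs; apply Hseg.
          replace (w0 + s * (w - w0) - w0) with (s * (w - w0)) by ring.
          rewrite Cmod_mult, Cmod_R, Rabs_pos_eq by lra.
          generalize (Cmod_ge_0 (w - w0)); nra.
        * apply (kernel_differentiable K); auto.
    - intros eps Heps.
      destruct (kernel_vanishes_at_infinity K L f HL Hcf eps Heps) as [A1 HA1].
      destruct (index_zero_at_infinity K L HL HD) as [A2 HA2].
      exists (Rmax A1 A2); intros z Hz.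
      assert (Hz1 := Rle_lt_trans _ _ _ (Rmax_l _ _) Hz).
      assert (Hz2 := Rle_lt_trans _ _ _ (Rmax_r _ _) Hz).
      destruct (HA1 z Hz1) as [HKz Hle].
      rewrite HGT by auto; exact Hle. }
  intros w Hw; rewrite <- HGin by exact Hw; apply HG.
Qed.

(** On K, f is the slope at w of z |-> (z - w) f z, so the claim is Dixon's result for that product.
    The point w is taken on K itself; if K is empty, L vanishes by its bound. *)
Lemma cauchy_theorem (Omega K : C -> Prop) (L : (C -> C) -> C) (f : C -> C) :
  open (T := C_UniformSpace) Omega -> analytic_on Omega f ->
  integral_on K L -> double_pole_free K L -> (forall z, K z -> Omega z) ->
  (forall w, ~ Omega w -> L (fun z => 1 / (z - w)) = 0) ->
  L f = 0.
Proof.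
  intros HO Hf HL HD HK H0.
  assert (Hcf : continuous_along K f)
    by (intros z Hz; apply differentiable_continuous, Hf, HK, Hz).
  destruct (classic (exists w, K w)) as [[w Hw]|He].
  - assert (HF : analytic_on Omega (fun z => (z - w) * f z)).
    { intros z Hz; apply differentiable_mult; [|apply Hf, Hz].
      apply differentiable_minus; [apply differentiable_id|apply differentiable_const]. }
    rewrite <- (dixon Omega K L _ HO HF HL HD HK H0 w (HK w Hw)).
    apply (int_ext K); auto.
    + apply (slope_continuous_along Omega); auto.
    + intros z Hz; symmetry.
      apply (factors_at_slope (fun z => (z - w) * f z) f); [|ring].
      apply factors_at_global; [apply Hcf, Hw|intros u; ring].
  - apply (int_zero K); auto; intros z Hz; exfalso; eauto.
Qed.

Lemma cauchy_formula (Omega K : C -> Prop) (L : (C -> C) -> C) (f : C -> C) (w : C) :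
  open (T := C_UniformSpace) Omega -> analytic_on Omega f ->
  integral_on K L -> double_pole_free K L -> (forall z, K z -> Omega z) ->
  (forall w, ~ Omega w -> L (fun z => 1 / (z - w)) = 0) ->
  Omega w -> ~ K w ->
  L (fun z => f z / (z - w)) = f w * L (fun z => 1 / (z - w)).
Proof.
  intros HO Hf HL HD HK H0 Hw HwK.
  assert (C2 : continuous_along K (fun z => 1 / (z - w))) by (intros z Hz; eauto with ccont).
  assert (Cs : continuous_along K (slope f w)) by (apply (slope_continuous_along Omega); auto).
  transitivity (L (fun z => slope f w z + f w * (1 / (z - w)))).
  - apply (int_ext K); auto.
    + intros z Hz.
      assert (continuous (T := C_UniformSpace) (U := C_UniformSpace) f z)
        by (apply differentiable_continuous, Hf, HK, Hz).
      eauto with ccont.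
    + intros z Hz; apply continuous_Cplus; [apply Cs, Hz|].
      apply continuous_Cmult; [apply continuous_Cconst|apply C2, Hz].
    + intros z Hz; rewrite (slope_eq f w z) at 1.
      field; eapply off_neq; eassumption.
  - rewrite (int_lin _ _ HL), (dixon Omega K L f HO Hf HL HD HK H0 w Hw) by assumption; ring.
Qed.

(** * Cycles *)

Lemma integral_on_ext (K K' : C -> Prop) (L L' : (C -> C) -> C) :
  (forall z, K z <-> K' z) -> (forall F, continuous_along K F -> L F = L' F) ->
  integral_on K L -> integral_on K' L'.
Proof.
  intros HK HL H.
  assert (HC : forall F, continuous_along K' F -> continuous_along K F)
    by (intros F HF z Hz; apply HF, HK, Hz).
  split.
  - intros F G k HF HG; apply HC in HF; apply HC in HG.
    rewrite <- (HL F HF), <- (HL G HG), <- (HL (fun z => F z + k * G z))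
      by (intros z Hz; auto with ccont).
    apply (int_lin _ _ H); assumption.
  - destruct (int_bound _ _ H) as (M & HM0 & HM); exists M; split; [exact HM0|].
    intros F B HB HF HFB; rewrite <- HL by auto; apply HM; auto.
    intros z Hz; apply HFB, HK, Hz.
  - intros F HF; destruct (int_compact _ _ H F (HC F HF)) as (B & HB0 & HB).
    exists B; split; [exact HB0|intros z Hz; apply HB, HK, Hz].
Qed.

(** Used with k = 1 to concatenate pieces and add paths, and with k = -1 for the difference of two
    cycles. *)
Lemma integral_on_comb (K1 K2 : C -> Prop) (L1 L2 : (C -> C) -> C) (k : C) :
  integral_on K1 L1 -> integral_on K2 L2 ->
  integral_on (fun z => K1 z \/ K2 z) (fun F => L1 F + k * L2 F).
Proof.
  intros H1 H2.
  assert (HC : forall F, continuous_along (fun z => K1 z \/ K2 z) F ->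
            continuous_along K1 F /\ continuous_along K2 F)
    by (intros F HF; split; intros z Hz; apply HF; auto).
  split.
  - intros F G l HF HG; destruct (HC F HF), (HC G HG).
    rewrite (int_lin _ _ H1), (int_lin _ _ H2) by assumption; ring.
  - destruct (int_bound _ _ H1) as (M1 & HM01 & HM1), (int_bound _ _ H2) as (M2 & HM02 & HM2).
    assert (Hk := Cmod_ge_0 k).
    exists (M1 + Cmod k * M2)%R; split; [nra|].
    intros F B HB HF HFB; destruct (HC F HF) as [C1 C2].
    eapply Rle_trans; [apply Cmod_triangle|]; rewrite Cmod_mult.
    specialize (HM1 F B HB C1 (fun z Hz => HFB z (or_introl Hz))).
    specialize (HM2 F B HB C2 (fun z Hz => HFB z (or_intror Hz))).
    rewrite Rmult_plus_distr_r, Rmult_assoc.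
    apply Rplus_le_compat; [exact HM1|apply Rmult_le_compat_l; assumption].
  - intros F HF; destruct (HC F HF) as [C1 C2].
    destruct (int_compact _ _ H1 F C1) as (B1 & HB01 & HB1).
    destruct (int_compact _ _ H2 F C2) as (B2 & HB02 & HB2).
    exists (B1 + B2)%R; split; [lra|].
    intros z [Hz|Hz]; [specialize (HB1 z Hz)|specialize (HB2 z Hz)]; lra.
Qed.

(** * From one-sided derivatives to piecewise C^1 paths and cycles *)

Lemma is_derive_Re_Im (g : R -> C) (t : R) (l : C) :
  is_derive (V := C_R_NormedModule) g t l ->
  is_derive (fun s => Re (g s)) t (Re l) /\ is_derive (fun s => Im (g s)) t (Im l).
Proof.
  rewrite is_derive_R_C; intros H.
  split; (split; [apply is_linear_scal_l|]); intros x Hx;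
    replace x with t by exact (is_filter_lim_locally_unique _ _ Hx); intros eps;
    (refine (filter_imp _ _ _ (H eps (cond_pos eps))); intros s Hs);
    (eapply Rle_trans; [|exact Hs]);
    set (z := g s - g t - (s - t)%R * l).
  - change (Rabs ((Re (g s) - Re (g t)) - (s - t) * Re l) <= Cmod z)%R.
    replace ((Re (g s) - Re (g t)) - (s - t) * Re l)%R with (fst z)
      by (unfold z, Re; simpl; ring).
    eapply Rle_trans; [apply Rmax_l|apply Rmax_Cmod].
  - change (Rabs ((Im (g s) - Im (g t)) - (s - t) * Im l) <= Cmod z)%R.
    replace ((Im (g s) - Im (g t)) - (s - t) * Im l)%R with (snd z)
      by (unfold z, Im; simpl; ring).
    eapply Rle_trans; [apply Rmax_r|apply Rmax_Cmod].
Qed.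

Lemma C1_on_spec (g : R -> C) (u v : R) :
  C1_on g u v -> exists dg : R -> C, forall t, (u <= t <= v)%R ->
    forall eps : R, (0 < eps)%R -> exists d : R, (0 < d)%R /\
      forall s, (u <= s <= v)%R -> (Rabs (s - t) < d)%R ->
        (Cmod (g s - g t - RtoC (s - t) * dg t) <= eps * Rabs (s - t))%R /\
        (Cmod (dg s - dg t) < eps)%R.
Proof.
  intros [dg H]; exists dg; intros t Ht eps Heps.
  destruct (H t Ht) as [[_ H1] H2].
  specialize (H1 t (fun P HP => filter_le_within _ P HP) (mkposreal eps Heps)).
  specialize (H2 (fun w => (Cmod (w - dg t) < eps)%R)).
  assert (H3 : locally (T := C_UniformSpace) (dg t) (fun w => (Cmod (w - dg t) < eps)%R)).
  { apply locally_Cmod; exists eps; auto. }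
  apply H2 in H3.
  destruct (filter_and _ _ H1 H3) as [d Hd].
  exists d; split; [apply cond_pos|].
  intros s Hs Hst; destruct (Hd s Hst Hs) as [G1 G2]; split; [|exact G2].
  rewrite <- scal_R_C, Cmod_norm; exact G1.
Qed.

(* A C^1 function on [u, v] is continued by its tangents at the end points. *)
Lemma C1_on_arc (g : R -> C) (u v : R) :
  (u < v)%R -> C1_on g u v ->
  exists zeta dzeta : R -> C, C1_arc zeta dzeta u v /\
    (forall t, (u <= t <= v)%R -> zeta t = g t) /\
    (forall t, (u < t < v)%R -> path_derive g t = dzeta t).
Proof.
  intros Huv H; destruct (C1_on_spec _ _ _ H) as [dg Hdg].
  (* [c] clamps to [u, v]: [s - c s] is 0 inside, so [zeta] is g there, and outside it measures the
     progress along the end tangent. *)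
  set (c := fun s => Rmax u (Rmin v s)).
  assert (Hc : forall s, (u <= c s <= v)%R).
  { intros s; unfold c, Rmax, Rmin; repeat destruct Rle_dec; lra. }
  assert (Hc1 : forall t, (u <= t <= v)%R -> c t = t).
  { intros t Ht; unfold c, Rmax, Rmin; repeat destruct Rle_dec; lra. }
  assert (Hc2 : forall s t, (u <= t <= v)%R ->
            (Rabs (c s - t) <= Rabs (s - t))%R /\ (Rabs (s - c s) <= Rabs (s - t))%R).
  { intros s t Ht; unfold c, Rmax, Rmin; repeat destruct Rle_dec;
      split; unfold Rabs; repeat destruct Rcase_abs; lra. }
  set (zeta := fun s => g (c s) + RtoC (s - c s) * dg (c s)).
  assert (Hz : forall t, (u <= t <= v)%R -> zeta t = g t).
  { intros t Ht; unfold zeta; rewrite (Hc1 t Ht), Rminus_diag; ring. }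
  assert (HA : C1_arc zeta (fun s => dg (c s)) u v).
  { intros t Ht; rewrite (Hc1 t Ht); split.
    - apply is_derive_R_C; intros eps Heps.
      destruct (Hdg t Ht (eps / 2)%R ltac:(lra)) as (d & Hd & Hnear).
      exists (mkposreal d Hd); intros s Hs.
      change (Rabs (s - t) < d)%R in Hs.
      destruct (Hc2 s t Ht) as [D1 D2].
      destruct (Hnear (c s) (Hc s) ltac:(lra)) as [N1 N2].
      rewrite (Hz t Ht); unfold zeta.
      replace (g (c s) + RtoC (s - c s) * dg (c s) - g t - RtoC (s - t) * dg t)
        with ((g (c s) - g t - RtoC (c s - t) * dg t) + RtoC (s - c s) * (dg (c s) - dg t))
        by (rewrite !RtoC_minus; ring).
      eapply Rle_trans; [apply Cmod_triangle|].
      rewrite Cmod_mult, Cmod_R.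
      assert (P1 := Rabs_pos (s - c s)); assert (P2 := Rabs_pos (s - t)).
      assert (P3 := Cmod_ge_0 (dg (c s) - dg t)).
      assert (Q1 : (eps / 2 * Rabs (c s - t) <= eps / 2 * Rabs (s - t))%R)
        by (apply Rmult_le_compat_l; lra).
      assert (Q2 : (Rabs (s - c s) * Cmod (dg (c s) - dg t) <= Rabs (s - t) * (eps / 2))%R)
        by (apply Rmult_le_compat; lra).
      lra.
    - apply continuous_Cmod; intros eps Heps.
      destruct (Hdg t Ht eps Heps) as (d & Hd & Hnear).
      exists (mkposreal d Hd); intros s Hs.
      change (Rabs (s - t) < d)%R in Hs.
      destruct (Hc2 s t Ht) as [D1 D2].
      rewrite (Hc1 t Ht); apply Hnear; [apply Hc|lra]. }
  exists zeta, (fun s => dg (c s)); split; [exact HA|split; [exact Hz|]].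
  intros t Ht.
  destruct (HA t ltac:(lra)) as [D _]; apply is_derive_Re_Im in D; destruct D as [D1 D2].
  assert (Hloc : locally t (fun s => zeta s = g s)).
  { assert (Hm : (0 < Rmin (t - u) (v - t))%R) by (apply Rmin_pos; lra).
    exists (mkposreal _ Hm); intros s Hs; apply Hz.
    change (Rabs (s - t) < Rmin (t - u) (v - t))%R in Hs.
    assert (Hs1 := Rlt_le_trans _ _ _ Hs (Rmin_l _ _)).
    assert (Hs2 := Rlt_le_trans _ _ _ Hs (Rmin_r _ _)).
    apply Rabs_def2 in Hs1; apply Rabs_def2 in Hs2; lra. }
  unfold path_derive; apply injective_projections; simpl; apply is_derive_unique.
  - apply (is_derive_ext_loc (fun s => Re (zeta s))); [|exact D1].
    revert Hloc; apply filter_imp; intros s ->; reflexivity.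
  - apply (is_derive_ext_loc (fun s => Im (zeta s))); [|exact D2].
    revert Hloc; apply filter_imp; intros s ->; reflexivity.
Qed.

Definition segment_integral (g : R -> C) (u v : R) (F : C -> C) : C :=
  CRInt (fun t => F (g t) * path_derive g t) u v.

(** The properties that survive concatenation. [path_derive] may be meaningless at a node, so a
    whole path is not a [C1_arc]; integrability is recorded because the additivity of the integral
    over intervals calls for it. *)
Record segment_spec (g : R -> C) (u v : R) : Prop := {
  seg_le : (u <= v)%R;
  seg_ex : forall F, continuous_along (arc_trace g u v) F ->
    ex_CRInt (fun t => F (g t) * path_derive g t) u v;
  seg_on : integral_on (arc_trace g u v) (segment_integral g u v);
  seg_double_pole : forall w, ~ arc_trace g u v w ->
    segment_integral g u v (fun z => 1 / (z - w) / (z - w)) = / (g u - w) - / (g v - w)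
}.

Lemma segment_point (g : R -> C) (u : R) : segment_spec g u u.
Proof.
  assert (E : forall F, segment_integral g u u F = 0)
    by (intros F; apply (RInt_point (V := C_R_CompleteNormedModule))).
  split.
  - lra.
  - intros F _; apply ex_RInt_point.
  - split.
    + intros F G k _ _; rewrite !E; ring.
    + exists 0%R; split; [lra|]; intros F B HB _ _; rewrite E, Cmod_0; lra.
    + intros F _; exists (Cmod (F (g u))); split; [apply Cmod_ge_0|].
      intros z [t [Ht <-]]; replace t with u by lra; lra.
  - intros w _; rewrite E; ring.
Qed.

Lemma segment_C1 (g : R -> C) (u v : R) :
  (u < v)%R -> C1_on g u v -> segment_spec g u v.
Proof.
  intros Huv H; destruct (C1_on_arc g u v Huv H) as (zeta & dzeta & HA & Hz & Hd).
  assert (Huv' : (u <= v)%R) by lra.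
  assert (HK : forall z, arc_trace zeta u v z <-> arc_trace g u v z).
  { intros z; split; intros [t [Ht E]]; exists t; split; auto.
    - rewrite <- Hz; assumption.
    - rewrite Hz; assumption. }
  assert (HE : forall F t, (Rmin u v < t < Rmax u v)%R ->
            F (zeta t) * dzeta t = F (g t) * path_derive g t).
  { intros F t; rewrite Rmin_left, Rmax_right by exact Huv'; intros Ht.
    rewrite Hd, Hz by lra; reflexivity. }
  assert (HI : forall F, arc_integral zeta dzeta u v F = segment_integral g u v F)
    by (intros F; apply CRInt_ext, HE).
  split; auto.
  - intros F HF.
    apply (ex_RInt_ext (V := C_R_NormedModule) (fun t => F (zeta t) * dzeta t)).
    + apply HE.
    + apply ex_arc_integral; auto.
      intros z Hz'; apply HF, HK, Hz'.
  - apply (integral_on_ext (arc_trace zeta u v) _ (arc_integral zeta dzeta u v)); auto.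
    apply arc_integral_on; assumption.
  - intros w Hw; rewrite <- HI, arc_double_pole_free; auto.
    + rewrite !Hz by lra; reflexivity.
    + rewrite HK; exact Hw.
Qed.

Lemma segment_cat (g : R -> C) (u m v : R) :
  segment_spec g u m -> segment_spec g m v -> segment_spec g u v.
Proof.
  intros S1 S2.
  assert (H1 := seg_le _ _ _ S1); assert (H2 := seg_le _ _ _ S2).
  assert (HK : forall z, (arc_trace g u m z \/ arc_trace g m v z) <-> arc_trace g u v z).
  { intros z; split.
    - intros [[t [Ht E]]|[t [Ht E]]]; exists t; split; auto; lra.
    - intros [t [Ht E]]; destruct (Rle_lt_dec t m); [left|right]; exists t; split; auto; lra. }
  assert (HC : forall F, continuous_along (arc_trace g u v) F ->
            continuous_along (arc_trace g u m) F /\ continuous_along (arc_trace g m v) F)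
    by (intros F HF; split; intros z Hz; apply HF, HK; auto).
  assert (HI : forall F, continuous_along (arc_trace g u v) F ->
            segment_integral g u v F = segment_integral g u m F + segment_integral g m v F).
  { intros F HF; destruct (HC F HF); apply CRInt_Chasles.
    - apply (seg_ex _ _ _ S1); assumption.
    - apply (seg_ex _ _ _ S2); assumption. }
  split.
  - lra.
  - intros F HF; destruct (HC F HF).
    apply (ex_RInt_Chasles (V := C_R_NormedModule) _ u m v).
    + apply (seg_ex _ _ _ S1); assumption.
    + apply (seg_ex _ _ _ S2); assumption.
  - apply (integral_on_ext _ _ _ _ HK) with
      (2 := integral_on_comb _ _ _ _ 1 (seg_on _ _ _ S1) (seg_on _ _ _ S2)).
    intros F HF; rewrite HI; [ring|].
    intros z Hz; apply HF, HK, Hz.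
  - intros w Hw.
    rewrite HI by (intros z Hz; eauto 8 with ccont).
    rewrite (seg_double_pole _ _ _ S1), (seg_double_pole _ _ _ S2)
      by (intros Hw'; apply Hw, HK; auto).
    ring.
Qed.

Lemma segment_pieces (g : R -> C) (v : R) (ts : list R) :
  forall u, C1_pieces g u v ts -> segment_spec g u v.
Proof.
  induction ts as [|t ts IH]; simpl; intros u H.
  - subst; apply segment_point.
  - destruct H as (H1 & H2 & H3); apply segment_cat with t; auto using segment_C1.
Qed.

Lemma path_spec (g : closed_path) : segment_spec g (path_lo g) (path_hi g).
Proof. destruct (path_C1 g) as [ts H]; apply (segment_pieces g _ ts), H. Qed.

Lemma path_double_pole_free (g : closed_path) :
  double_pole_free (arc_trace g (path_lo g) (path_hi g)) (path_integral g).
Proof.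
  intros w Hw; transitivity (/ (g (path_lo g) - w) - / (g (path_hi g) - w)).
  - apply (seg_double_pole _ _ _ (path_spec g)), Hw.
  - rewrite (path_closed g); ring.
Qed.

Lemma on_cycle_cons (g : closed_path) (gamma : cycle) (z : C) :
  arc_trace g (path_lo g) (path_hi g) z \/ on_cycle gamma z <-> on_cycle (g :: gamma) z.
Proof.
  split.
  - intros [H|(h & Hh & H)]; [exists g|exists h]; simpl; auto.
  - intros (h & [<-|Hh] & H); [left; exact H|right; exists h; auto].
Qed.

Lemma cycle_integral_on (gamma : cycle) :
  integral_on (on_cycle gamma) (cycle_integral gamma).
Proof.
  induction gamma as [|g gamma IH].
  - split.
    + intros F G k _ _; simpl; ring.
    + exists 0%R; split; [lra|]; intros F B HB _ _; simpl; rewrite Cmod_0; lra.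
    + intros F _; exists 0%R; split; [lra|]; intros z (g & [] & _).
  - apply (integral_on_ext _ _ _ _ (on_cycle_cons g gamma)) with
      (2 := integral_on_comb _ _ _ _ 1 (seg_on _ _ _ (path_spec g)) IH).
    intros F _; simpl; unfold path_integral, segment_integral; ring.
Qed.

Lemma cycle_double_pole_free (gamma : cycle) :
  double_pole_free (on_cycle gamma) (cycle_integral gamma).
Proof.
  induction gamma as [|g gamma IH]; intros w Hw; [reflexivity|].
  simpl; rewrite IH, path_double_pole_free; [ring| |];
    intros H; apply Hw, on_cycle_cons; auto.
Qed.

(** * Newton's expansion *)

Lemma cycle_index_integral (gamma : cycle) (w k : C) :
  ~ on_cycle gamma w -> Ind gamma w = k ->
  cycle_integral gamma (fun z => 1 / (z - w)) = 2 * PI * Ci * k.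
Proof.
  intros Hw <-; unfold Ind.
  transitivity (cycle_integral gamma (fun z => / (z - w))).
  - apply (int_ext _ _ _ _ (cycle_integral_on gamma)).
    + intros z Hz; eauto with ccont.
    + intros z Hz; eauto with ccont.
    + intros z Hz; field; eapply off_neq; eassumption.
  - generalize C2PIi_neq0; generalize (2 * PI * Ci); intros c Hc; field; exact Hc.
Qed.

Lemma cycle_cauchy_formula (Omega : C -> Prop) (gamma : cycle) (f : C -> C) (w : C) :
  open (T := C_UniformSpace) Omega -> analytic_on Omega f -> cycle_in Omega gamma ->
  homologous_to_zero Omega gamma -> Omega w -> has_index_one gamma w ->
  f w = / (2 * PI * Ci) * cycle_integral gamma (fun z => f z / (z - w)).
Proof.
  intros HO Hf Hin Hhom Hw [Hoff Hind].
  rewrite (cauchy_formula Omega (on_cycle gamma)); auto using cycle_integral_on,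
    cycle_double_pole_free.
  - rewrite (cycle_index_integral gamma w 1) by assumption.
    generalize C2PIi_neq0; generalize (2 * PI * Ci); intros c Hc; field; exact Hc.
  - intros u Hu; rewrite (cycle_index_integral gamma u 0); [ring| |apply Hhom, Hu].
    intros H; apply Hu, Hin, H.
Qed.

(** Outside Omega both indices are 0 and on P both are 1, so the difference has index 0 at every
    point outside the punctured domain. *)
Lemma homologous_cycles_integral (Omega P : C -> Prop) (gamma gamma' : cycle) (F : C -> C) :
  open (T := C_UniformSpace) (fun z => Omega z /\ ~ P z) ->
  analytic_on (fun z => Omega z /\ ~ P z) F ->
  cycle_in Omega gamma -> cycle_in Omega gamma' ->
  homologous_to_zero Omega gamma -> homologous_to_zero Omega gamma' ->
  (forall w, P w -> has_index_one gamma w) -> (forall w, P w -> has_index_one gamma' w) ->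
  cycle_integral gamma F = cycle_integral gamma' F.
Proof.
  intros HO HF Hin Hin' Hhom Hhom' HP HP'.
  set (L := fun F => cycle_integral gamma F + (- (1)) * cycle_integral gamma' F).
  assert (H : L F = 0).
  { apply (cauchy_theorem (fun z => Omega z /\ ~ P z)
      (fun z => on_cycle gamma z \/ on_cycle gamma' z)); auto.
    - apply integral_on_comb; apply cycle_integral_on.
    - intros w Hw; unfold L; rewrite !cycle_double_pole_free by tauto; ring.
    - intros z [Hz|Hz]; split; auto; intros HPz.
      + destruct (HP z HPz) as [Hoff _]; auto.
      + destruct (HP' z HPz) as [Hoff _]; auto.
    - intros w Hw; unfold L.
      destruct (classic (P w)) as [HPw|HPw].
      + destruct (HP w HPw), (HP' w HPw).
        rewrite !(cycle_index_integral _ w 1) by assumption; ring.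
      + assert (Hout : ~ Omega w) by tauto.
        rewrite !(cycle_index_integral _ w 0); [ring| | | |];
          try (apply Hhom; assumption); try (apply Hhom'; assumption);
          intros H; apply Hout; auto. }
  unfold L in H.
  transitivity (cycle_integral gamma F + - (1) * cycle_integral gamma' F
                + cycle_integral gamma' F); [ring|rewrite H; ring].
Qed.

(** * Finite products and Newton's identity under the integral *)

Lemma Cprod_ext (u v : nat -> C) (n : nat) :
  (forall j, (j < n)%nat -> u j = v j) -> Cprod u n = Cprod v n.
Proof.
  induction n as [|n IH]; simpl; intros H; [reflexivity|].
  rewrite IH, H; auto.
Qed.

Lemma Cprod_neq0 (u : nat -> C) (n : nat) :
  (forall j, (j < n)%nat -> u j <> 0) -> Cprod u n <> 0.
Proof.
  induction n as [|n IH]; simpl; intros H; [exact C1_nz|].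
  apply Cmult_neq_0; auto.
Qed.

Lemma Cprod_div (u v : nat -> C) (n : nat) :
  (forall j, (j < n)%nat -> v j <> 0) ->
  Cprod (fun j => u j / v j) n = Cprod u n / Cprod v n.
Proof.
  induction n as [|n IH]; simpl; intros H; [field|].
  rewrite IH by auto; field; split; [apply H; lia|apply Cprod_neq0; auto].
Qed.

Lemma Cprod_shift (u : nat -> C) (n : nat) :
  Cprod u (S n) = u O * Cprod (fun j => u (S j)) n.
Proof.
  induction n as [|n IH]; [simpl; ring|].
  change (Cprod u (S (S n))) with (Cprod u (S n) * u (S n)); rewrite IH; simpl; ring.
Qed.

Lemma Cprod_rev (u : nat -> C) (n : nat) :
  Cprod (fun j => u (n - j)%nat) (S n) = Cprod u (S n).
Proof.
  induction n as [|n IH]; [reflexivity|].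
  rewrite Cprod_shift; simpl (S n - 0)%nat.
  change (Cprod u (S (S n))) with (Cprod u (S n) * u (S n)); rewrite <- IH.
  simpl (S n - S _)%nat; ring.
Qed.

Lemma Cprod_continuous (u : nat -> C -> C) (n : nat) (z : C) :
  (forall j, (j < n)%nat -> continuous (T := C_UniformSpace) (U := C_UniformSpace) (u j) z) ->
  continuous (T := C_UniformSpace) (U := C_UniformSpace) (fun y => Cprod (fun j => u j y) n) z.
Proof.
  induction n as [|n IH]; simpl; intros H; [apply continuous_Cconst|].
  apply continuous_Cmult; auto.
Qed.

Lemma Cprod_differentiable (u : nat -> C -> C) (n : nat) (z : C) :
  (forall j, (j < n)%nat -> differentiable_at (u j) z) ->
  differentiable_at (fun y => Cprod (fun j => u j y) n) z.
Proof.
  induction n as [|n IH]; simpl; intros H; [apply differentiable_const|].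
  apply differentiable_mult; auto.
Qed.

(** The identity 1/(y - x) = 1/(y - u_m) + (x - u_m) / ((y - x)(y - u_m)), multiplied by f y and the
    first m quotients, then integrated. *)
Lemma remainder_step (K : C -> Prop) (L : (C -> C) -> C) (f : C -> C) (x : C)
    (u : nat -> C) (m : nat) :
  integral_on K L -> continuous_along K f -> ~ K x ->
  (forall j, (j <= m)%nat -> ~ K (u j)) ->
  L (fun y => f y / (y - x) * Cprod (fun j => (x - u j) / (y - u j)) m)
  = L (fun y => f y / Cprod (fun j => y - u j) (S m)) * Cprod (fun j => x - u j) m
    + L (fun y => f y / (y - x) * Cprod (fun j => (x - u j) / (y - u j)) (S m)).
Proof.
  intros HL Hf Hx Hu.
  assert (N : forall y j, K y -> (j <= m)%nat -> y - u j <> 0)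
    by (intros y j Hy Hj; eapply off_neq; eauto).
  assert (C1 : continuous_along K (fun y => f y / Cprod (fun j => y - u j) (S m))).
  { intros y Hy; apply continuous_Cdiv; [apply Hf, Hy| |].
    - apply (Cprod_continuous (fun j y => y - u j)); auto with ccont.
    - apply Cprod_neq0; intros j Hj; apply N; [exact Hy|lia]. }
  assert (C2 : forall n, (n <= S m)%nat -> continuous_along K
            (fun y => f y / (y - x) * Cprod (fun j => (x - u j) / (y - u j)) n)).
  { intros n Hn y Hy; assert (Cy := Hf y Hy); apply continuous_Cmult; [eauto with ccont|].
    apply (Cprod_continuous (fun j y => (x - u j) / (y - u j))).
    intros j Hj; apply continuous_Cdiv; auto with ccont; apply N; [exact Hy|lia]. }
  set (G := fun y => f y / Cprod (fun j => y - u j) (S m)) in *.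
  transitivity (L (fun y => f y / (y - x) * Cprod (fun j => (x - u j) / (y - u j)) (S m)
                            + Cprod (fun j => x - u j) m * G y)).
  - apply (int_ext K); auto.
    + intros y Hy; apply continuous_Cplus; [apply C2; auto|].
      apply continuous_Cmult; [apply continuous_Cconst|apply C1, Hy].
    + intros y Hy; unfold G; simpl.
      rewrite (Cprod_div (fun j => x - u j) (fun j => y - u j))
        by (intros; apply N; [exact Hy|lia]).
      field; repeat split; [apply N; auto| |eapply off_neq; eassumption].
      apply Cprod_neq0; intros j Hj; apply N; [exact Hy|lia].
  - rewrite (int_lin _ _ HL) by auto; ring.
Qed.

(** Valid for arbitrary nodes off K; P-sequences enter only when the coefficients are identified
    with the operators. *)
Lemma newton_expansion (K : C -> Prop) (L : (C -> C) -> C) (f : C -> C) (x : C)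
    (u : nat -> C) (n : nat) :
  integral_on K L -> continuous_along K f -> ~ K x ->
  (forall j, (j <= n)%nat -> ~ K (u j)) ->
  L (fun y => f y / (y - x))
  = sum_n (fun k => L (fun y => f y / Cprod (fun j => y - u j) (S k))
                    * Cprod (fun j => x - u j) k) n
    + L (fun y => f y / (y - x) * Cprod (fun j => (x - u j) / (y - u j)) (S n)).
Proof.
  intros HL Hf Hx Hu.
  induction n as [|n IH].
  - rewrite sum_O, <- (remainder_step K) by auto.
    assert (C1 : continuous_along K (fun y => f y / (y - x))).
    { intros y Hy; assert (Cy := Hf y Hy); eauto with ccont. }
    apply (int_ext K); auto.
    + intros y Hy; apply continuous_Cmult; [apply C1, Hy|apply continuous_Cconst].
    + intros y Hy; simpl; ring.
  - rewrite IH by auto.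
    rewrite sum_Sn, (remainder_step K L f x u (S n)) by auto.
    apply Cplus_assoc.
Qed.

(** * P-sequences and the evaluation of [partial] *)

Lemma P_sequence_root (a b c : C) (xs : Z -> C) (m : Z) (y : C) :
  P_sequence a b c xs -> Ppoly a b c (xs m) y = 0 ->
  y = xs (m + 1)%Z \/ y = xs (m - 1)%Z.
Proof.
  intros HP H; rewrite HP in H.
  destruct (Ceq_dec y (xs (m + 1)%Z)) as [E|N]; [auto|].
  destruct (Ceq_dec y (xs (m - 1)%Z)) as [E|N']; [auto|].
  exfalso; revert H; apply Cmult_neq_0; apply Cminus_eq_contra; assumption.
Qed.

(** Comparison of the coefficients of y in the defining identity, extracted from its values at y = 0
    and y = 1. *)
Lemma P_sequence_sum (a b c : C) (xs : Z -> C) (m : Z) :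
  P_sequence a b c xs ->
  xs (m + 1)%Z + xs (m - 1)%Z = 2 * A_of a b (xs m).
Proof.
  intros HP; assert (H0 := HP m 0); assert (H1 := HP m 1); unfold Ppoly in *.
  unfold A_of; set (s := xs (m + 1)%Z) in *; set (t := xs (m - 1)%Z) in *.
  transitivity (1 + (0 - s) * (0 - t) - (1 - s) * (1 - t)); [ring|].
  rewrite <- H0, <- H1; ring.
Qed.

Lemma P_sequence_shift (a b c : C) (xs : Z -> C) (k : Z) :
  P_sequence a b c xs -> P_sequence a b c (fun m => xs (m + k)%Z).
Proof.
  intros HP m y; rewrite HP.
  replace (m + 1 + k)%Z with (m + k + 1)%Z by ring.
  replace (m - 1 + k)%Z with (m + k - 1)%Z by ring; reflexivity.
Qed.

Lemma P_sequence_opp (a b c : C) (xs : Z -> C) :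
  P_sequence a b c xs -> P_sequence a b c (fun m => xs (- m)%Z).
Proof.
  intros HP m y; rewrite HP.
  replace (- (m + 1))%Z with (- m - 1)%Z by ring.
  replace (- (m - 1))%Z with (- m + 1)%Z by ring; ring.
Qed.

(** The sum of the two neighbours is a second-order recurrence that can be solved in both
    directions, so two adjacent values determine everything. The induction carries adjacent pairs at
    n and at -n. *)
Lemma P_sequence_unique (a b c : C) (xs ys : Z -> C) :
  P_sequence a b c xs -> P_sequence a b c ys ->
  xs 0%Z = ys 0%Z -> xs 1%Z = ys 1%Z -> forall m, xs m = ys m.
Proof.
  intros Hx Hy H0 H1.
  assert (R : forall zs, P_sequence a b c zs -> forall m,
            zs (m + 1)%Z = 2 * A_of a b (zs m) - zs (m - 1)%Z).
  { intros zs Hz m; rewrite <- (P_sequence_sum a b c zs m Hz); ring. }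
  assert (R' : forall zs, P_sequence a b c zs -> forall m,
            zs (m - 1)%Z = 2 * A_of a b (zs m) - zs (m + 1)%Z).
  { intros zs Hz m; rewrite <- (P_sequence_sum a b c zs m Hz); ring. }
  assert (HN : forall n : nat, (xs (Z.of_nat n) = ys (Z.of_nat n) /\
             xs (Z.of_nat n + 1)%Z = ys (Z.of_nat n + 1)%Z) /\
           (xs (- Z.of_nat n)%Z = ys (- Z.of_nat n)%Z /\
            xs (- Z.of_nat n + 1)%Z = ys (- Z.of_nat n + 1)%Z)).
  { induction n as [|n ((I1 & I2) & (I3 & I4))]; [simpl; auto|].
    rewrite !Nat2Z.inj_succ; unfold Z.succ; set (k := Z.of_nat n) in *.
    repeat split; auto.
    - rewrite (R xs Hx), (R ys Hy).
      replace (k + 1 - 1)%Z with k by ring; rewrite I1, I2; reflexivity.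
    - replace (- (k + 1))%Z with (- k - 1)%Z by ring.
      rewrite (R' xs Hx), (R' ys Hy), I3, I4; reflexivity.
    - replace (- (k + 1) + 1)%Z with (- k)%Z by ring; exact I3. }
  intros m; destruct (Z_le_gt_dec 0 m) as [Hm|Hm].
  - destruct (HN (Z.to_nat m)) as [[E _] _]; rewrite Z2Nat.id in E by lia; exact E.
  - destruct (HN (Z.to_nat (- m))) as [_ [E _]]; rewrite Z2Nat.id in E by lia.
    rewrite Z.opp_involutive in E; exact E.
Qed.

(** The next term of [xs] is a root of P at the common base point, hence one of the two neighbours
    in [ys]; this choice decides the direction. *)
Lemma P_sequence_base (a b c : C) (xs ys : Z -> C) :
  P_sequence a b c xs -> P_sequence a b c ys -> xs 0%Z = ys 0%Z ->
  (forall m, xs m = ys m) \/ (forall m, xs m = ys (- m)%Z).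
Proof.
  intros Hx Hy H0.
  assert (HP : Ppoly a b c (ys 0%Z) (xs 1%Z) = 0).
  { rewrite <- H0, Hx; simpl; ring. }
  destruct (P_sequence_root a b c ys 0 _ Hy HP) as [H1|H1]; [left|right].
  - apply (P_sequence_unique a b c); auto.
  - apply (P_sequence_unique a b c xs (fun m => ys (- m)%Z)); auto.
    apply P_sequence_opp, Hy.
Qed.

Lemma Phi_base_opp (xs : Z -> C) (k : nat) (y : C) :
  Phi (fun m => xs (- m)%Z) (S k) y = Phi xs (S k) y.
Proof.
  unfold Phi.
  rewrite <- (Cprod_rev (fun j => y - xs (2 * Z.of_nat j - (Z.of_nat (S k) - 1))%Z)).
  apply Cprod_ext; intros j Hj; do 2 f_equal; lia.
Qed.

(** Whatever square root s is taken, A + s is a root of P at z m, thus a neighbour of z m, and the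
    sum 2A makes A - s the other one. This supplies the domain condition of [is_partial]. *)
Lemma Omega_iter_P_sequence (a b c : C) (Omega : C -> Prop) (z : Z -> C) (k : nat) :
  P_sequence a b c z -> forall m,
  (forall j, (j <= k)%nat -> Omega (z (m + 2 * Z.of_nat j - Z.of_nat k)%Z)) ->
  Omega_iter a b c Omega k (z m).
Proof.
  intros HP; induction k as [|k IH]; intros m H.
  - simpl; specialize (H O (le_n _)).
    replace (m + 2 * Z.of_nat 0 - Z.of_nat 0)%Z with m in H by (simpl; ring); exact H.
  - assert (I1 : Omega_iter a b c Omega k (z (m + 1)%Z)).
    { apply IH; intros j Hj; specialize (H (S j) ltac:(lia)).
      replace (m + 1 + 2 * Z.of_nat j - Z.of_nat k)%Z
        with (m + 2 * Z.of_nat (S j) - Z.of_nat (S k))%Z by lia; exact H. }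
    assert (I2 : Omega_iter a b c Omega k (z (m - 1)%Z)).
    { apply IH; intros j Hj; specialize (H j ltac:(lia)).
      replace (m - 1 + 2 * Z.of_nat j - Z.of_nat k)%Z
        with (m + 2 * Z.of_nat j - Z.of_nat (S k))%Z by lia; exact H. }
    simpl; intros s Hs.
    assert (Hroot : Ppoly a b c (z m) (A_of a b (z m) + s) = 0).
    { transitivity (s * s - delta_of a b c (z m)); [|rewrite Hs; ring].
      unfold Ppoly, A_of, delta_of; ring. }
    assert (Hsum := P_sequence_sum a b c z m HP).
    assert (E : A_of a b (z m) - s
                = z (m + 1)%Z + z (m - 1)%Z - (A_of a b (z m) + s)) by (rewrite Hsum; ring).
    rewrite E.
    destruct (P_sequence_root a b c z m _ HP Hroot) as [-> | ->]; split; auto.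
    + replace (z (m + 1)%Z + z (m - 1)%Z - z (m + 1)%Z) with (z (m - 1)%Z) by ring; exact I2.
    + replace (z (m + 1)%Z + z (m - 1)%Z - z (m - 1)%Z) with (z (m + 1)%Z) by ring; exact I1.
Qed.

(** The deleted points are the zeros of one polynomial, whose non-vanishing is an open condition. *)
Lemma open_minus_finite (Omega : C -> Prop) (u : nat -> C) (n : nat) :
  open (T := C_UniformSpace) Omega ->
  open (T := C_UniformSpace) (fun z => Omega z /\ ~ exists j, (j <= n)%nat /\ z = u j).
Proof.
  intros HO z [Hz Hn].
  assert (H : locally (T := C_UniformSpace) z
                (fun w => Cprod (fun j => w - u j) (S n) <> 0)).
  { apply (continuous_neq0 (fun w => Cprod (fun j => w - u j) (S n))).
    - apply (Cprod_continuous (fun j w => w - u j)); auto with ccont.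
    - apply Cprod_neq0; intros j Hj; apply Cminus_eq_contra; intros E.
      apply Hn; exists j; split; [lia|exact E]. }
  refine (filter_imp _ _ _ (filter_and _ _ (HO z Hz) H)).
  intros w [Hw Hne]; split; [exact Hw|].
  intros (j & Hj & ->); apply Hne; clear - Hj.
  induction n as [|n IH]; simpl in *.
  - replace j with O by lia; ring.
  - destruct (Nat.eq_dec j (S n)) as [->|Hd]; [ring|].
    rewrite IH by lia; ring.
Qed.

(** Definite description asks for uniqueness, which compares every admissible pair of sequence and
    cycle with the given one, and for existence, witnessed by gamma and the shifted sequence. *)
Lemma partial_P_sequence (a b c : C) (Omega : C -> Prop) (gamma : cycle)
    (f : C -> C) (z : Z -> C) (k : nat) :
  open (T := C_UniformSpace) Omega -> cycle_in Omega gamma ->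
  homologous_to_zero Omega gamma -> analytic_on Omega f -> P_sequence a b c z ->
  (forall j : nat, (j <= k)%nat -> Omega (z (2 * Z.of_nat j)%Z)) ->
  (forall j : nat, (j <= k)%nat -> has_index_one gamma (z (2 * Z.of_nat j)%Z)) ->
  partial a b c Omega k f (z (Z.of_nat k))
  = / (2 * PI * Ci) * cycle_integral gamma
      (fun y => f y / Cprod (fun j => y - z (2 * Z.of_nat j)%Z) (S k)).
Proof.
  intros HO Hin Hhom Hf HP HzO HzI.
  set (u := fun j => z (2 * Z.of_nat j)%Z) in *.
  (* Since [z (Z.of_nat k)] encodes z_{k/2}, this recentres the sequence there; the index 2j - k of
     [zs] is then the node z_j. *)
  set (zs := fun m => z (m + Z.of_nat k)%Z).
  assert (HPz : P_sequence a b c zs) by (apply P_sequence_shift, HP).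
  assert (Hzs : forall j, zs (2 * Z.of_nat j - Z.of_nat k)%Z = u j).
  { intros j; unfold zs, u; f_equal; lia. }
  assert (HPhi : forall y, Phi zs (S k) y = Cprod (fun j => y - u j) (S k)).
  { intros y; apply Cprod_ext; intros j Hj; unfold zs, u; do 2 f_equal; lia. }
  assert (Hc : forall g : cycle, cycle_in Omega g ->
            (forall j, (j <= k)%nat -> ~ on_cycle g (u j)) ->
            continuous_along (on_cycle g) (fun y => f y / Cprod (fun j => y - u j) (S k))).
  { intros g Hg Hoff y Hy; apply continuous_Cdiv.
    - apply differentiable_continuous, Hf, Hg, Hy.
    - apply (Cprod_continuous (fun j y => y - u j)); auto with ccont.
    - apply Cprod_neq0; intros j Hj; apply Cminus_eq_contra; intros ->.
      apply (Hoff j); [lia|exact Hy]. }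
  assert (HcPhi : forall (g : cycle) xs, (forall y, Phi xs (S k) y = Phi zs (S k) y) ->
            cycle_in Omega g -> (forall j, (j <= k)%nat -> ~ on_cycle g (u j)) ->
            cycle_integral g (fun y => f y / Phi xs (S k) y)
            = cycle_integral g (fun y => f y / Cprod (fun j => y - u j) (S k))).
  { intros g xs Hxs Hg Hoff; apply (int_ext _ _ _ _ (cycle_integral_on g)).
    - intros y Hy; apply continuous_ext with (fun y => f y / Cprod (fun j => y - u j) (S k)).
      + intros y'; rewrite Hxs, HPhi; reflexivity.
      + exact (Hc g Hg Hoff y Hy).
    - apply Hc; auto.
    - intros y Hy; rewrite Hxs, HPhi; reflexivity. }
  unfold partial; apply (iota_unique (V := C_R_CompleteNormedModule)).
  - intros v (_ & xs & g & HPx & Hx0 & Hg & Hghom & Hgind & ->).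
    assert (Hbase : xs 0%Z = zs 0%Z) by (rewrite Hx0; reflexivity).
    assert (HX : (forall y, Phi xs (S k) y = Phi zs (S k) y) /\
                 forall j, (j <= k)%nat -> has_index_one g (u j)).
    { destruct (P_sequence_base a b c xs zs HPx HPz Hbase) as [E|E]; split.
      - intros y; apply Cprod_ext; intros j _; rewrite E; reflexivity.
      - intros j Hj; rewrite <- Hzs, <- E; apply Hgind, Hj.
      - intros y; rewrite <- (Phi_base_opp zs).
        apply Cprod_ext; intros j _; rewrite E; reflexivity.
      - intros j Hj; rewrite <- Hzs.
        (* Reversing the sequence exchanges the nodes j and k - j, so the set of nodes is
           unchanged. *)
        replace (2 * Z.of_nat j - Z.of_nat k)%Z
          with (- (2 * Z.of_nat (k - j) - Z.of_nat k))%Z by lia.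
        rewrite <- E; apply Hgind; lia. }
    destruct HX as [HX HgI].
    f_equal; rewrite HcPhi by (auto; intros j Hj; apply HgI, Hj).
    set (P := fun w => exists j, (j <= k)%nat /\ w = u j).
    apply (homologous_cycles_integral Omega P); auto.
    + apply open_minus_finite, HO.
    + intros w [Hw HPw]; apply differentiable_div; [apply Hf, Hw| |].
      * apply (Cprod_differentiable (fun j y => y - u j)); intros j _.
        apply differentiable_minus; [apply differentiable_id|apply differentiable_const].
      * apply Cprod_neq0; intros j Hj; apply Cminus_eq_contra; intros ->.
        apply HPw; exists j; split; [lia|reflexivity].
    + intros w (j & Hj & ->); apply HgI, Hj.
    + intros w (j & Hj & ->); apply HzI, Hj.
  - split.
    + apply Omega_iter_P_sequence; [exact HP|].
      intros j Hj; replace (Z.of_nat k + 2 * Z.of_nat j - Z.of_nat k)%Z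
        with (2 * Z.of_nat j)%Z by ring; apply HzO, Hj.
    + exists zs, gamma.
      refine (conj HPz (conj eq_refl (conj Hin (conj Hhom (conj _ _))))).
      * intros j Hj; rewrite Hzs; apply HzI; auto.
      * f_equal; symmetry; apply HcPhi; auto.
        intros j Hj; apply HzI, Hj.
Qed.

Theorem theorem2p3 (a b c : C) (Omega : C -> Prop) (gamma : cycle)
    (f : C -> C) (x : C) (n : nat) (z : Z -> C)
    (Omega_open : open Omega)
    (gamma_in : cycle_in Omega gamma)
    (gamma_hom : homologous_to_zero Omega gamma)
    (f_analytic : analytic_on Omega f)
    (x_in : Omega x) (x_ind : has_index_one gamma x)
    (z_Pseq : P_sequence a b c z)
    (z_in : forall j : nat, (j <= n)%nat -> Omega (z (2 * Z.of_nat j)%Z))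
    (z_ind : forall j : nat, (j <= n)%nat ->
       has_index_one gamma (z (2 * Z.of_nat j)%Z)) :
  f x = sum_n (fun k : nat =>
          partial a b c Omega k f (z (Z.of_nat k))
          * Cprod (fun j => x - z (2 * Z.of_nat j)%Z) k) n
        + remainder gamma z n f x.
Proof.
  set (u := fun j => z (2 * Z.of_nat j)%Z) in *.
  rewrite (cycle_cauchy_formula Omega gamma f x) by assumption.
  rewrite (newton_expansion (on_cycle gamma) (cycle_integral gamma) f x u n).
  - rewrite Cmult_plus_distr_l; unfold remainder; fold u; f_equal.
    (* The factor 1/(2 pi i) moves into the sum, where it normalizes each coefficient to the value
       given by [partial_P_sequence]. *)
    rewrite <- (sum_n_mult_l (K := C_Ring)).
    apply sum_n_ext_loc; intros k Hk.
    rewrite (partial_P_sequence a b c Omega gamma) 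
      by (try assumption; intros j Hj; (apply z_in || apply z_ind); lia).
    apply Cmult_assoc.
  - apply cycle_integral_on.
  - intros y Hy; apply differentiable_continuous, f_analytic, gamma_in, Hy.
  - apply x_ind.
  - intros j Hj; apply z_ind, Hj.
Qed.
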